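(* Let $X$ be a Banach space satisfying $n_K(X)>0$. Suppose that there is a mapping $\eta\colon(0,1)\longrightarrow(0,1)$ such that given $\delta>0$, $x_1^*,\ldots,x_n^*\in B_{X^*}$ and $x_1,\ldots,x_\ell\in B_X$, we can find norm one operators $\widetilde{P}\colon X\longrightarrow\widetilde{P}(X)$ and $i\colon\widetilde{P}(X)\longrightarrow X$ such that for $P:=i\circ\widetilde{P}\colon X\longrightarrow X$ the following conditions are satisfied: (i) $\|P^*(x_j^* )-x_j^*\|<\delta$ for $j=1,\ldots,n$; (ii) $\|P(x_j)-x_j\|<\delta$ for $j=1,\ldots,\ell$; (iii) $\widetilde{P}\circ i=\mathrm{Id}_{\widetilde{P}(X)}$; (iv) $\widetilde{P}(X)$ has the BPBp-nu for compact operators with the mapping $\eta$; (v) either $P$ is an absolute projection and $i$ is the natural inclusion, or $n_K(\widetilde{P}(X))=n_K(X)=1$. Then $X$ has the BPBp-nu for compact operators.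
   Context: Banach spaces are over $\mathbb{K}=\mathbb{R}$ or $\mathbb{C}$. For a Banach space $X$, $B_X$ and $S_X$ are its closed unit ball and unit sphere, $X^*$ its dual, $\mathcal{K}(X)$ the space of compact linear operators from $X$ to $X$, and $\Pi(X)=\{(x,x^* )\in S_X\times S_{X^*}: x^*(x)=1\}$. The numerical radius of a bounded linear operator $T$ on $X$ is $\nu(T)=\sup\{|x^*(T(x))|:(x,x^* )\in\Pi(X)\}$. The compact numerical index of $X$ is $n_K(X)=\inf\{\nu(T):T\in\mathcal{K}(X),\ \|T\|=1\}$, equivalently $n_K(X)=\max\{k\ge 0: k\|T\|\le\nu(T)\ \forall T\in\mathcal{K}(X)\}$. Operators are bounded and linear; $\widetilde{P}(X)$ denotes a Banach space which is the range of $\widetilde{P}$. A Banach space $X$ has the Bishop-Phelps-Bollobás property for numerical radius for compact operators (BPBp-nu for compact operators) if for every $0<\varepsilon<1$ there exists $\eta(\varepsilon)\in(0,1)$ such that whenever $T\in\mathcal{K}(X)$ and $(x,x^* )\in\Pi(X)$ satisfy $\nu(T)=1$ and $|x^*(T(x))|>1-\eta(\varepsilon)$, there exist $S\in\mathcal{K}(X)$ and $(y,y^* )\in\Pi(X)$ such that $\nu(S)=|y^*(S(y))|=1$, $\|T-S\|<\varepsilon$, $\|x-y\|<\varepsilon$ and $\|x^*-y^*\|<\varepsilon$. It has the property with a given mapping $\eta\colon(0,1)\to(0,1)$ if this holds for every $\varepsilon$ with that value $\eta(\varepsilon)$. An absolute norm $|\cdot|_a$ is a norm on $\mathbb{R}^2$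 such that $|(1,0)|_a=|(0,1)|_a=1$ and $|(s,t)|_a=|(|s|,|t|)|_a$ for all $(s,t)\in\mathbb{R}^2$. A projection $P$ on $X$ is an absolute projection if there is an absolute norm $|\cdot|_a$ such that $\|x\|=|(\|P(x)\|,\|x-P(x)\|)|_a$ for every $x\in X$. *)

(* Defs.v *)
From HB Require Import structures.
From mathcomp Require Import all_boot all_order all_algebra.
From mathcomp Require Import all_classical all_reals all_analysis.
From mathcomp.real_closed Require Export complex.
Set Implicit Arguments.
Unset Strict Implicit.
Unset Printing Implicit Defensive.
Import Order.TTheory GRing.Theory Num.Theory.
Import numFieldNormedType.Exports.

Local Open Scope classical_set_scope.
Local Open Scope ring_scope.

(* The scalar field K is the numFieldType underlying R or R[i], R : realType.
   As everywhere in MathComp-Analysis, norms are K-valued, so a real number is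
   an element of Num.real K: in R[i] these are the complex numbers with zero
   imaginary part, and u <= v means that v - u is a nonnegative real.  Hence
   suprema and infima of sets of reals are taken in the partial order of K. *)

Section NumericalRadius.
Context {K : numFieldType}.
Implicit Types X Y : normedModType K.

Definition opnorm X Y (T : X -> Y) : K :=
  supremum 0 [set `|T x| | x in [set x : X | `|x| <= 1]].

(* K^o is K as a normed space over itself, so that {linear X -> K^o} is the
   algebraic dual of X; the topological dual is cut out by continuity. *)
Definition dual_ball X (xs : {linear X -> K^o}) : Prop :=
  continuous xs /\ opnorm xs <= 1.

Definition dual_sphere X (xs : {linear X -> K^o}) : Prop :=
  continuous xs /\ opnorm xs = 1.

Definition states X : set (X * {linear X -> K^o}) :=
  [set u | [/\ `|u.1| = 1, dual_sphere u.2 & u.2 u.1 = 1]].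

Definition compact_operator X (T : {linear X -> X}) : Prop :=
  continuous T /\ precompact (T @` [set x : X | `|x| <= 1]).

Definition numerical_radius X (T : X -> X) : K :=
  supremum 0 [set `|u.2 (T u.1)| | u in @states X].

Definition compact_numerical_index X : K :=
  infimum 0 [set numerical_radius T | T in
    [set T : {linear X -> X} | compact_operator T /\ opnorm T = 1]].

Definition BPBp_nu_compact_at X (eps eta : K) : Prop :=
  forall (T : {linear X -> X}) (x : X) (xs : {linear X -> K^o}),
    compact_operator T -> states (x, xs) ->
    numerical_radius T = 1 -> 1 - eta < `|xs (T x)| ->
    exists (S : {linear X -> X}) (y : X) (ys : {linear X -> K^o}),
      [/\ compact_operator S, states (y, ys),
          numerical_radius S = 1 /\ `|ys (S y)| = 1 &
          [/\ opnorm (T \- S) < eps, `|x - y| < eps & opnorm (xs \- ys) < eps]].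

Definition BPBp_nu_compact_with X (eta : K -> K) : Prop :=
  forall eps : K, 0 < eps < 1 -> BPBp_nu_compact_at X eps (eta eps).

Definition BPBp_nu_compact X : Prop :=
  forall eps : K, 0 < eps < 1 ->
    exists2 eta : K, 0 < eta < 1 & BPBp_nu_compact_at X eps eta.

End NumericalRadius.

Section AbsoluteProjection.
Context {K : numFieldType}.

(* N is a norm on the real plane: only its values at real arguments matter. *)
Definition absolute_norm (N : K -> K -> K) : Prop :=
  [/\ {in Num.real &, forall s t, 0 <= N s t},
      {in Num.real &, forall s t, N s t = 0 -> s = 0 /\ t = 0},
      {in Num.real & &, forall a s t, N (a * s) (a * t) = `|a| * N s t},
      (forall s t s' t', s \is Num.real -> t \is Num.real ->
         s' \is Num.real -> t' \is Num.real ->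
         N (s + s') (t + t') <= N s t + N s' t') &
      [/\ N 1 0 = 1, N 0 1 = 1 &
          {in Num.real &, forall s t, N s t = N `|s| `|t|}]].

Definition absolute_projection (X : normedModType K) (P : X -> X) : Prop :=
  (forall x, P (P x) = P x) /\
  exists2 N : K -> K -> K, absolute_norm N &
    forall x, `|x| = N `|P x| `|x - P x|.

(* A Banach space Y is a subspace of X, with the norm of X, precisely through
   an isometric linear map, the inclusion. *)
Definition natural_inclusion (X Y : normedModType K) (i : {linear Y -> X}) :
  Prop := forall y, `|i y| = `|y|.

End AbsoluteProjection.

(* Main.v *)
Require Import Defs.
From HB Require Import structures.
From mathcomp Require Import all_boot all_order all_algebra.
From mathcomp Require Import all_classical all_reals all_analysis.
From mathcomp.real_closed Require Import complex.
From mathcomp Require Import ring lra.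
Set Implicit Arguments.
Unset Strict Implicit.
Unset Printing Implicit Defensive.
Import Order.TTheory GRing.Theory Num.Theory.
Import numFieldNormedType.Exports.
Local Open Scope classical_set_scope.
Local Open Scope ring_scope.

(* Let T be compact with nu(T) = 1, almost attaining its numerical radius at (x, f).
   A finite net of T(B_X) and finitely many functionals g o T yield a retract (Q, i)
   onto Y such that P = i Q satisfies P T P close to T.  The pair (Q x, f i) almost
   lies in Pi(Y), so the Bishop-Phelps-Bollobas theorem replaces it by a pair of Pi(Y)
   at which Q T i, once normalised, almost attains its numerical radius.  The property
   of Y gives an operator S1 attaining at some (y, g), and i S1 Q attains at
   (i y, g Q).  Its numerical radius does not exceed 1: when the index is 1 because
   |S1| <= nu(S1), and when P is absolute because each (x, f) in Pi(X) restricts to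
   P(X) as a functional attaining its norm at P x.  The hypothesis n_K(X) > 0 bounds
   |T| independently of T, hence the cost of the normalisation. *)

(* The two fields are treated uniformly: imag is 0 when K is R and i when K is R[i],
   so that reE recovers a scalar from the real parts of a and imag * a. *)
Record real_scalars (R : realType) (K : numFieldType) := RealScalars {
  toK : {rmorphism R -> K};
  re : K -> R;
  imag : K;
  reD : {morph re : a b / a + b};
  reZ : forall r a, re (toK r * a) = r * re a;
  re1 : re 1 = 1;
  re_imag : re imag = 0;
  imagM : imag = 0 \/ imag * imag = -1;
  reE : forall a, a = toK (re a) - imag * toK (re (imag * a));
  ler_toK : {mono toK : r s / r <= s};
  toK_norm : forall a : K, toK (re `|a|) = `|a|;
  re_le_norm : forall a : K, re a <= re `|a|;
  re_eq_norm : forall a : K, re a = re `|a| -> a = `|a| }.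

Lemma real_scalars_real (R : realType) : real_scalars R R.
Proof.
apply: (@RealScalars R R idfun id 0) => //.
- by left.
- by move=> a /=; rewrite mul0r subr0.
- exact: ler_norm.
Qed.

Lemma real_scalars_complex (R : realType) : real_scalars R R[i].
Proof.
apply: (@RealScalars R R[i] (real_complex R) (@complex.Re R) 'i%C).
- by move=> [a b] [c d].
- by move=> r [a b]; rewrite /= mul0r subr0.
- by [].
- by [].
- by right; rewrite -expr2 sqr_i.
- by move=> [a b]; apply/eqP; rewrite eq_complex /=; apply/andP; split; apply/eqP; ring.
- by move=> r s; rewrite lecR.
- by move=> a; rewrite normc_def.
- move=> [a b]; rewrite normc_def /=.
  apply: le_trans (ler_norm a) _; rewrite -sqrtr_sqr ler_sqrt ?addr_ge0 ?sqr_ge0//.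
  by rewrite lerDl sqr_ge0.
- move=> [a b]; rewrite normc_def /= => ab.
  have a0 : 0 <= a by rewrite ab sqrtr_ge0.
  have : a ^+ 2 = a ^+ 2 + b ^+ 2.
    by rewrite {1}ab sqr_sqrtr// addr_ge0 ?sqr_ge0.
  move=> /eqP; rewrite -[X in X == _]add0r [X in _ == X]addrC (inj_eq (addIr _)).
  rewrite eq_sym sqrf_eq0 => /eqP b0.
  by rewrite -ab b0.
Qed.

Lemma real_scalars_of (R : realType) (K : numFieldType) :
  K = R :> numFieldType \/ K = R[i] :> numFieldType ->
  inhabited (real_scalars R K).
Proof.
by case=> ->; constructor; [exact: real_scalars_real|exact: real_scalars_complex].
Qed.

(** * Real numbers inside the scalar field *)

Section ScalarTheory.
Context {R : realType} {K : numFieldType} (S : real_scalars R K).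
Local Notation "r %:K" := (toK S r) (at level 2, format "r %:K").
Implicit Types (r s : R) (a b : K).

Lemma ltr_toK : {mono toK S : r s / r < s}.
Proof. exact: leW_mono (ler_toK S). Qed.

Lemma toK_ge0 r : (0 <= r%:K) = (0 <= r).
Proof. by rewrite -(rmorph0 (toK S)) ler_toK. Qed.

Lemma re_toK r : re S r%:K = r.
Proof. by rewrite -[r%:K]mulr1 reZ re1 mulr1. Qed.

Lemma toK_re a : 0 <= a -> (re S a)%:K = a.
Proof. by move=> /ger0_norm <-; rewrite toK_norm. Qed.

Lemma re0 : re S 0 = 0.
Proof. by rewrite -(rmorph0 (toK S)) re_toK. Qed.

Lemma reN a : re S (- a) = - re S a.
Proof. by have := reZ S (-1) a; rewrite rmorphN1 !mulN1r. Qed.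

Lemma reB a b : re S (a - b) = re S a - re S b.
Proof. by rewrite reD reN. Qed.

(** Turning a value by a unimodular scalar makes it equal to its modulus, so that bounds on real
    parts become bounds on moduli. *)
Lemma rotation a : exists2 c : K, `|c| = 1 & c * a = `|a|.
Proof.
have [->|a0] := eqVneq a 0; first by exists 1; rewrite ?normr1 ?mulr0 ?normr0.
by exists (`|a| / a); rewrite ?divfK// normf_div normr_id divff// normr_eq0.
Qed.

End ScalarTheory.

(** * Real-valued norms, operator bounds, suprema and states *)

Section RealNorm.
Context {R : realType} {K : numFieldType} (S : real_scalars R K).
Local Notation "r %:K" := (toK S r) (at level 2, format "r %:K").
Implicit Types X Y Z : normedModType K.

(** The norm is moved from [K] to [R], where the order is total and linear arithmetic applies. *)
Definition real_norm X (x : X) : R := re S `|x|.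

Section Basic.
Context {X : normedModType K}.
Implicit Types x y : X.

Lemma toK_rnorm x : (real_norm x)%:K = `|x|.
Proof. exact/toK_re. Qed.

Lemma rnorm_ge0 x : 0 <= real_norm x.
Proof. by rewrite -(toK_ge0 S) toK_rnorm. Qed.

Lemma rnorm_le x r : (real_norm x <= r) = (`|x| <= r%:K).
Proof. by rewrite -(ler_toK S) toK_rnorm. Qed.

Lemma rnorm_lt x r : (real_norm x < r) = (`|x| < r%:K).
Proof. by rewrite -(ltr_toK S) toK_rnorm. Qed.

Lemma rnorm0 : real_norm (0 : X) = 0.
Proof. by rewrite /real_norm normr0 re0. Qed.

Lemma rnorm0_eq0 x : real_norm x <= 0 -> x = 0.
Proof. by rewrite rnorm_le rmorph0 normr_le0 => /eqP. Qed.

Lemma rnormN x : real_norm (- x) = real_norm x.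
Proof. by rewrite /real_norm normrN. Qed.

Lemma rnorm_distC x y : real_norm (x - y) = real_norm (y - x).
Proof. by rewrite /real_norm distrC. Qed.

Lemma rnormD x y : real_norm (x + y) <= real_norm x + real_norm y.
Proof. by rewrite rnorm_le rmorphD /= !toK_rnorm ler_normD. Qed.

Lemma rnormB x y : real_norm (x - y) <= real_norm x + real_norm y.
Proof. by rewrite -(rnormN y) rnormD. Qed.

Lemma rnorm_triangle y x z : real_norm (x - z) <= real_norm (x - y) + real_norm (y - z).
Proof. by have := rnormD (x - y) (y - z); rewrite addrA subrK. Qed.

Lemma rnormZ_norm (a : K) x : real_norm (a *: x) = real_norm (a : K^o) * real_norm x.
Proof. by rewrite /real_norm normrZ -[X in X * _](toK_norm S) reZ. Qed.

Lemma rnorm_toK r : real_norm (r%:K : K^o) = `|r|.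
Proof.
rewrite /real_norm; case: (ger0P r) => r0.
  by rewrite ger0_norm ?re_toK// toK_ge0.
by rewrite ltr0_norm ?reN ?re_toK// -(rmorph0 (toK S)) ltr_toK.
Qed.

Lemma rnormZ r x : 0 <= r -> real_norm (r%:K *: x) = r * real_norm x.
Proof. by move=> r0; rewrite rnormZ_norm rnorm_toK ger0_norm. Qed.

End Basic.

Lemma re_le_rnorm (a : K^o) : re S a <= real_norm a.
Proof. exact: re_le_norm. Qed.

(** A pointwise bound is easier to compose than [opnorm], which is a supremum that has to be shown
    to exist. *)
Definition obound X Y (T : X -> Y) (c : R) := forall x, real_norm (T x) <= c * real_norm x.

Lemma obound_comp X Y Z (T : X -> Y) (U : Y -> Z) c d :
  0 <= d -> obound T c -> obound U d -> obound (U \o T) (d * c).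
Proof.
move=> d0 hT hU x; apply: le_trans (hU _) _.
by rewrite -mulrA ler_wpM2l.
Qed.

Lemma obound_continuous X Y (T : {linear X -> Y}) c : obound T c -> continuous T.
Proof.
move=> hT; apply: bounded_linear_continuous; apply/linear_boundedP.
near=> r => x; rewrite -!toK_rnorm.
(* The constant [c] may be negative; its maximum with 0 has a nonnegative, hence real, image in
   [K]. *)
apply: le_trans (_ : (Num.max c 0)%:K * (real_norm x)%:K <= _).
  rewrite -rmorphM ler_toK; apply: le_trans (hT x) _.
  by rewrite ler_wpM2r ?rnorm_ge0// le_max lexx.
rewrite ler_wpM2r ?toK_ge0 ?rnorm_ge0//.
near: r; apply: nbhs_pinfty_ge; apply: ger0_real.
by rewrite toK_ge0 le_max lexx orbT.
Unshelve. all: by end_near. Qed.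

Lemma continuous_obound X Y (T : {linear X -> Y}) :
  continuous T -> exists2 c, 0 <= c & obound T c.
Proof.
move=> /linear_bounded_continuous/linear_boundedP/pinfty_ex_gt0[r r0 hr].
exists (re S r) => [|x]; first by rewrite -(toK_ge0 S) toK_re ltW.
by rewrite -(ler_toK S) rmorphM /= (toK_re S (ltW r0)) !toK_rnorm.
Qed.

(** The elements of [A] are nonnegative, and so is each of its upper bounds since [A] is nonempty.
    All of them come from [R], so the supremum of the real parts is also the supremum in the partial
    order of [K]. *)
Lemma sup_real (A : set K) c :
  A !=set0 -> (forall a, A a -> 0 <= a) -> (forall a, A a -> a <= c%:K) ->
  exists s, [/\ supremum 0 A = s%:K, forall a, A a -> a <= s%:K &
     forall d, (forall a, A a -> a <= d%:K) -> s <= d].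
Proof.
move=> A0 Apos Ac; pose B := re S @` A; pose s := sup B.
have hB : has_sup B.
  split; first by case: A0 => a Aa; exists (re S a); exists a.
  by exists c => _ [a Aa <-]; rewrite -(ler_toK S) toK_re; [exact: Ac|exact: Apos].
have ubs a : A a -> a <= s%:K.
  move=> Aa; rewrite -(toK_re S (Apos _ Aa)) ler_toK.
  by apply: sup_upper_bound => //; exists a.
have lubs d : (forall a, A a -> a <= d%:K) -> s <= d.
  move=> hd; apply: ge_sup; first exact: hB.1.
  by move=> _ [a Aa <-]; rewrite -(ler_toK S) toK_re; [exact: hd|exact: Apos].
exists s; split=> //.
rewrite /supremum; case: ifPn => [/eqP A00|_].
  by case: A0 => a; rewrite A00.
have sups : supremums A s%:K.
  split; first exact: ubs.
  move=> b hb; have b0 : 0 <= b.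
    by case: A0 => a Aa; apply: le_trans (Apos _ Aa) (hb _ Aa).
  rewrite -(toK_re S b0) ler_toK; apply: lubs => a /hb.
  by rewrite (toK_re S b0).
case: xgetP => [b _ [ub lb]|/(_ s%:K)//].
by apply: le_anti; rewrite lb ?(proj2 sups).
Qed.

(** By homogeneity, the supremum over the unit ball is the least pointwise bound. *)
Lemma opnormP X Y (T : {linear X -> Y}) c : 0 <= c -> obound T c ->
  exists s, [/\ 0 <= s, opnorm T = s%:K, obound T s &
    forall d, 0 <= d -> obound T d -> s <= d].
Proof.
move=> c0 hT; rewrite /opnorm.
have [||_ [x /= x1 <-]|s [-> hs1 hs2]] := @sup_real
   [set `|T x| | x in [set x : X | `|x| <= 1]] c.
- by exists `|T 0|; exists 0 => //=; rewrite normr0.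
- by move=> _ [x _ <-].
- rewrite -rnorm_le; apply: le_trans (hT x) _.
  by rewrite -[leRHS]mulr1 ler_wpM2l// rnorm_le rmorph1.
have s0 : 0 <= s.
  rewrite -(toK_ge0 S); apply: le_trans (hs1 `|T 0| _) => //.
  by exists 0 => //=; rewrite normr0.
exists s; split => //.
  move=> x; have [x0|x0] := leP (real_norm x) 0.
    by rewrite (rnorm0_eq0 x0) linear0 !rnorm0 mulr0.
  have : real_norm (T ((real_norm x)^-1%:K *: x)) <= s.
    rewrite rnorm_le; apply: hs1; exists ((real_norm x)^-1%:K *: x) => //=.
    rewrite -(rmorph1 (toK S)) -rnorm_le rnormZ ?invr_ge0 ?rnorm_ge0//.
    by rewrite mulVf// gt_eqF.
  rewrite linearZ rnormZ ?invr_ge0 ?rnorm_ge0//.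
  by rewrite mulrC ler_pdivrMr.
move=> d d0 hd; apply: hs2 => _ [x /= x1 <-]; rewrite -rnorm_le.
apply: le_trans (hd x) _.
by rewrite -[leRHS]mulr1 ler_wpM2l// rnorm_le rmorph1.
Qed.

Lemma opnorm_obound X Y (T : {linear X -> Y}) r :
  continuous T -> opnorm T <= r%:K -> obound T r.
Proof.
move=> /continuous_obound[c c0 hc]; have [s [_ -> hs _]] := opnormP c0 hc.
rewrite ler_toK => sr x; apply: le_trans (hs x) _.
by rewrite ler_wpM2r ?rnorm_ge0.
Qed.

Lemma obound_opnorm X Y (T : {linear X -> Y}) r :
  0 <= r -> obound T r -> opnorm T <= r%:K.
Proof.
move=> r0 hr; have [s [_ -> _ h]] := opnormP r0 hr.
by rewrite ler_toK h.
Qed.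

Lemma opnorm_eq1 X Y (T : {linear X -> Y}) x :
  obound T 1 -> real_norm x = 1 -> 1 <= real_norm (T x) -> opnorm T = 1.
Proof.
move=> hT x1 Tx; have [s [_ -> hs h]] := opnormP ler01 hT.
rewrite -(rmorph1 (toK S)); congr (toK S _).
apply: le_anti; rewrite h//=; apply: le_trans Tx _.
by have := hs x; rewrite x1 mulr1.
Qed.

Lemma dual_ballP X (f : {linear X -> K^o}) : dual_ball f <-> obound f 1.
Proof.
split=> [[cf f1]|f1]; first by apply: opnorm_obound => //; rewrite rmorph1.
split; first exact: obound_continuous f1.
by rewrite -(rmorph1 (toK S)) obound_opnorm.
Qed.

Lemma statesP X x (f : {linear X -> K^o}) :
  states (x, f) <-> [/\ real_norm x = 1, obound f 1 & f x = 1].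
Proof.
split=> [[/= x1 [cf f1] fx]|[x1 f1 fx]].
  split=> //; first by rewrite /real_norm x1 re1.
  by apply: opnorm_obound => //; rewrite f1 rmorph1.
split => //=; first by rewrite -toK_rnorm x1 rmorph1.
split; first exact: obound_continuous f1.
by apply: opnorm_eq1 f1 x1 _; rewrite fx /real_norm normr1 re1.
Qed.

Lemma rnorm1 : real_norm (1 : K^o) = 1.
Proof. by rewrite /real_norm normr1 re1. Qed.

Lemma states_le X (T : X -> X) x (f : {linear X -> K^o}) c :
  obound T c -> states (x, f) -> real_norm (f (T x)) <= c.
Proof.
move=> hT /statesP[x1 f1 fx]; apply: le_trans (f1 _) _.
by rewrite mul1r; apply: le_trans (hT x) _; rewrite x1 mulr1.
Qed.

Lemma numerical_radius_le X (T : X -> X) c : 0 <= c ->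
  (forall x f, states (x, f) -> real_norm (f (T x)) <= c) -> numerical_radius T <= c%:K.
Proof.
(* Without states the supremum is its default value 0, which is why [0 <= c] is assumed. *)
move=> c0 h; have [A0|/set0P A0] := eqVneq
    [set `|u.2 (T u.1)| | u in @states K X] set0.
  by rewrite /numerical_radius /supremum A0 eqxx toK_ge0.
rewrite /numerical_radius.
have [||s [-> _ hs]] := sup_real A0 (c := c).
- by move=> _ [u _ <-].
- by move=> _ [[x f] /= xf <-]; rewrite -toK_rnorm ler_toK h.
- by rewrite ler_toK; apply: hs => _ [[x f] /= xf <-]; rewrite -toK_rnorm ler_toK h.
Qed.

Lemma numerical_radius_ge X (T : X -> X) c x (f : {linear X -> K^o}) :
  obound T c -> states (x, f) -> `|f (T x)| <= numerical_radius T.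
Proof.
move=> hT xf; rewrite /numerical_radius.
have [|||s [-> hs _]] := @sup_real [set `|u.2 (T u.1)| | u in @states K X] c.
- by exists `|f (T x)|; exists (x, f).
- by move=> _ [u _ <-].
- by move=> _ [[y g] /= yg <-]; rewrite -rnorm_le; exact: states_le hT yg.
- by apply: hs; exists (x, f).
Qed.

End RealNorm.

(** * Compact operators and the compact numerical index *)

Lemma precompact_image (K : numFieldType) (X Y : normedModType K) (f : X -> Y)
  (A : set X) : continuous f -> precompact A -> precompact (f @` A).
Proof.
move=> cf [B AB [cB _]].
apply: (@precompact_subset _ _ (f @` B)).
  by move=> _ [x Ax <-]; exists x => //; exact: AB.
apply: compact_precompact; first exact: norm_hausdorff.
by apply: continuous_compact => //; exact: continuous_subspaceT.
Qed.

(** The image of the unit ball under [S] lies in the image under [U] of a precompact set. This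
    serves for multiples and for both [Q \o T \o i] and [i \o S1 \o Q]. *)
Lemma compact_operator_sandwich (K : numFieldType) (X Y : normedModType K)
    (T : {linear X -> X}) (S : {linear Y -> Y}) (U : X -> Y) :
  compact_operator T -> continuous S -> continuous U ->
  (forall y, `|y| <= 1 -> exists2 x, `|x| <= 1 & S y = U (T x)) ->
  compact_operator S.
Proof.
move=> [_ pT] cS cU hS; split => //.
apply: precompact_subset (precompact_image cU pT) => _ [y /= y1 <-].
have [x x1 ->] := hS y y1.
by exists (T x) => //; exists x.
Qed.

Section Index.
Context {R : realType} {K : numFieldType} (S : real_scalars R K).
Local Notation "r %:K" := (toK S r) (at level 2, format "r %:K").
Context {X : normedModType K}.

Lemma compact_operatorZ (T : {linear X -> X}) r : 
  compact_operator T -> compact_operator (r%:K \*: T).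
Proof.
move=> cT; have cZ : continuous (fun x : X => r%:K *: x).
  by move=> x; apply: cvgZr; exact: cvg_id.
apply: (compact_operator_sandwich cT _ cZ) => [|y y1]; last by exists y.
move=> x /=; apply: continuous_comp; [exact: cT.1|exact: cZ].
Qed.

(** If the norm [s] of [T] is positive, then [T / s] competes in the infimum, so
    [n <= nu(T / s) <= n * c / s], whence [s <= c]. *)
Lemma compact_numerical_index_le (T : {linear X -> X}) n c : 0 < n -> 0 <= c ->
  compact_numerical_index X = n%:K -> compact_operator T ->
  (forall x f, states (x, f) -> real_norm S (f (T x)) <= n * c) -> obound S T c.
Proof.
move=> n0 c0 hn cT hT; have [d d0 hd] := continuous_obound S cT.1.
have [s [s0 Ts hs hs']] := opnormP d0 hd.
suff sc : s <= c.
  by move=> x; apply: le_trans (hs x) _; rewrite ler_wpM2r ?rnorm_ge0.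
have [s_le0|s_gt0] := leP s 0; first exact: le_trans c0.
pose T' : {linear X -> X} := s^-1%:K \*: T.
have T'1 : opnorm T' = 1.
  have T'b : obound S T' 1.
    move=> x; rewrite /T' /= rnormZ ?invr_ge0// mul1r -ler_pdivlMl ?invr_gt0//.
    by rewrite invrK.
  have [s' [s'0 -> hs1 hs2]] := opnormP ler01 T'b.
  rewrite -(rmorph1 (toK S)); congr (toK S _); apply: le_anti; rewrite hs2//=.
  (* Since [s] is the least bound of [T], the bound [s * s'] forces [1 <= s']. *)
  have /hs' : obound S T (s * s').
    move=> x; have := hs1 x; rewrite /T' /= rnormZ ?invr_ge0// => h.
    by rewrite -mulrA -ler_pdivrMl.
  by rewrite mulr_ge0// => /(_ isT); rewrite -ler_pdivrMl// mulVf ?gt_eqF.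
have : n%:K <= numerical_radius T'.
  have := hn; rewrite /compact_numerical_index /infimum.
  (* Being nonzero, [n%:K] is not the default value of [infimum], so it really is a lower bound. *)
  have n_neq0 : 0 <> n%:K :> K.
    by move/eqP; rewrite -(rmorph0 (toK S)) (inj_eq (fmorph_inj _)) lt_eqF.
  case: ifPn => // _; case: xgetP => // _ -> [lb _] <-.
  by apply: lb; exists T' => //; split => //; exact: compact_operatorZ.
have /[swap] /le_trans/[apply] : numerical_radius T' <= (s^-1 * (n * c))%:K.
  apply: numerical_radius_le => [|x f xf].
    by rewrite mulr_ge0 ?invr_ge0// mulr_ge0// ltW.
  rewrite /T' /= linearZ rnormZ ?invr_ge0//.
  by rewrite ler_pM2l ?invr_gt0// hT.
by rewrite ler_toK ler_pdivlMl// mulrC ler_pM2l.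
Qed.

End Index.

(** * The Hahn-Banach theorem for real functionals, with constraints on a convex cone *)

Section HahnBanach.
Context {R : realType} {K : numFieldType} (S : real_scalars R K).
Local Notation "r %:K" := (toK S r) (at level 2, format "r %:K").
Context {V : lmodType K}.
Implicit Types (p q h : V -> R) (u v : V) (C : set (V * R)).

(** [V] is a module over [K], but the functionals are real, so homogeneity only concerns scalars
    coming from [R]. *)
Definition sublinear p :=
  (forall u v, p (u + v) <= p u + p v) /\
  (forall t u, 0 <= t -> p (t%:K *: u) <= t * p u).

Definition real_linear h :=
  (forall u v, h (u + v) = h u + h v) /\ (forall t u, h (t%:K *: u) = t * h u).

Definition convex_cone C :=
  [/\ C (0, 0), forall u v a b, C (u, a) -> C (v, b) -> C (u + v, a + b) &
      forall t u a, 0 <= t -> C (u, a) -> C (t%:K *: u, t * a)].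

Lemma sublinear_le0 p : sublinear p -> p 0 <= 0.
Proof. by case=> _ /(_ 0 0 (lexx _)); rewrite rmorph0 scale0r mul0r. Qed.

Lemma sublinear_ge p u : sublinear p -> - p (- u) <= p u.
Proof.
move=> sp; have := sp.1 u (- u); rewrite subrr.
have : 0 <= p 0 by have := sp.1 0 0; rewrite addr0; lra.
lra.
Qed.

(** A pair [(u, a)] of [C] stands for the constraint [a <= h u]. Under the hypotheses [sp], [cC] and
    [Cp] below, the linear functionals dominated by this one are the [h] dominated by [p] that meet
    every constraint. *)
Definition cone_infimal p C v := inf [set p (v + w.1) - w.2 | w in C].

Section ConeInfimal.
Variables (p : V -> R) (C : set (V * R)).
Hypotheses (sp : sublinear p) (cC : convex_cone C).
Hypothesis Cp : forall u a, C (u, a) -> a <= p u.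

Lemma cone_infimal_le v u a : C (u, a) -> cone_infimal p C v <= p (v + u) - a.
Proof.
move=> Cu; apply: ge_inf; last by exists (u, a).
(* Subadditivity and [b <= p w] give this lower bound, so the infimum is a genuine one. *)
exists (- p (- v)) => _ [[w b] /= Cw <-].
have := Cp Cw; have := sp.1 (v + w) (- v); rewrite addrAC subrr add0r; lra.
Qed.

Lemma le_cone_infimal v r :
  (forall u a, C (u, a) -> r <= p (v + u) - a) -> r <= cone_infimal p C v.
Proof.
move=> h; apply: lb_le_inf.
  by exists (p (v + 0) - 0), (0, 0) => //; case: cC.
by move=> _ [[w b] /= Cw <-]; exact: h.
Qed.

Lemma sublinear_cone_infimal : sublinear (cone_infimal p C).
Proof.
case: cC => C0 CD CZ; split=> [u v|t u].
  rewrite -lerBlDr; apply: le_cone_infimal => w a Cw.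
  rewrite lerBlDr -lerBlDl; apply: le_cone_infimal => w' b Cw'.
  have := cone_infimal_le (u + v) (CD _ _ _ _ Cw Cw').
  by have := sp.1 (u + w) (v + w'); rewrite addrACA; lra.
rewrite le_eqVlt => /predU1P[<-|t0].
  rewrite rmorph0 scale0r mul0r; have := cone_infimal_le 0 C0.
  by have := sublinear_le0 sp; rewrite addr0; lra.
rewrite -ler_pdivrMl//; apply: le_cone_infimal => w a Cw.
rewrite ler_pdivrMl//.
have := cone_infimal_le (t%:K *: u) (CZ t _ _ (ltW t0) Cw).
have := sp.2 t (u + w) (ltW t0); rewrite scalerDr; lra.
Qed.

Lemma cone_infimal_le_self v : cone_infimal p C v <= p v.
Proof. by case: cC => /(cone_infimal_le v); rewrite addr0 subr0. Qed.

Lemma cone_infimalN u a : C (u, a) -> cone_infimal p C (- u) <= - a.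
Proof.
by move=> /(cone_infimal_le (- u)); rewrite addNr; have := sublinear_le0 sp; lra.
Qed.

End ConeInfimal.

(* A minimal sublinear functional q is linear: the infimum of q (v + t u) - t q u
   over t >= 0 is sublinear and at most q, hence equal to q. *)
Lemma hahn_banach p : sublinear p -> exists2 h, real_linear h & forall v, h v <= p v.
Proof.
move=> sp; pose T := {q : V -> R | sublinear q /\ forall v, q v <= p v}.
(* The order is reversed: a maximal element for Zorn's lemma is a minimal sublinear functional. *)
pose le (q q' : T) := `[< forall v, sval q' v <= sval q v >].
have [||||[q [sq qp]] qmin] := @Zorn T le.
- by move=> q; apply/asboolP.
- move=> q r s /asboolP h1 /asboolP h2; apply/asboolP => v.
  exact: le_trans (h2 v) (h1 v).
- move=> [q hq] [r hr] /asboolP /= h1 /asboolP /= h2.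
  by apply: eq_exist; apply/funext => v; apply: le_anti; rewrite h1 h2.
- move=> A totA; have [[q0 Aq0]|A0] := pselect (A !=set0); last first.
    exists (exist _ p (conj sp (fun v => lexx _))) => q Aq.
    by case: A0; exists q.
  (* The bound of a nonempty chain is its pointwise infimum, finite because each member is at least
     [- p (- v)]. Totality of the chain gives its subadditivity. *)
  pose q v := inf [set sval r v | r in A].
  have qle r v : A r -> q v <= sval r v.
    move=> Ar; apply: ge_inf; last by exists r.
    exists (- p (- v)) => _ [r' _ <-].
    have [sr' r'p] := svalP r'; apply: le_trans (sublinear_ge v sr').
    by rewrite lerN2.
  have leq v a : (forall r, A r -> a <= sval r v) -> a <= q v.
    move=> h; apply: lb_le_inf; first by exists (sval q0 v), q0.
    by move=> _ [r Ar <-]; exact: h.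
  have sq : sublinear q.
    split=> [u v|t u].
      rewrite -lerBlDr; apply: (leq) => r Ar.
      rewrite lerBlDr -lerBlDl; apply: (leq) => s As; rewrite lerBlDl.
      have [/asboolP rs|/asboolP sr] := totA _ _ Ar As.
        have := qle s (u + v) As; have := (svalP s).1.1 u v; have := rs u; lra.
      by have := qle r (u + v) Ar; have := (svalP r).1.1 u v; have := sr v; lra.
    rewrite le_eqVlt => /predU1P[<-|t0].
      rewrite rmorph0 scale0r mul0r; apply: le_trans (qle q0 0 Aq0) _.
      exact: sublinear_le0 (svalP q0).1.
    rewrite -ler_pdivrMl//; apply: (leq) => r Ar; rewrite ler_pdivrMl//.
    by apply: le_trans (qle r _ Ar) _; exact: ((svalP r).1.2 t u (ltW t0)).
  have qp v : q v <= p v by apply: le_trans (qle _ v Aq0) _; exact: (svalP q0).2.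
  by exists (exist _ q (conj sq qp)) => r Ar; apply/asboolP => v; exact: qle.
have qD u v : q (u + v) = q u + q v.
  apply: le_anti; rewrite sq.1 /=.
  (* The ray through [(v, q v)] encodes the constraint [q v <= h v]. By minimality
     [cone_infimal q C] is [q], and its bound at [(v, q v)] reads [q u <= q (u + v) - q v]. *)
  pose C := [set (t%:K *: v, t * q v) | t in [set t | 0 <= t]].
  have cC : convex_cone C.
    split.
    - by exists 0 => //=; rewrite rmorph0 scale0r mul0r.
    - move=> w w' a b [s /= s0 [<- <-]] [t /= t0 [<- <-]].
      by exists (s + t); rewrite /= ?addr_ge0// rmorphD scalerDl mulrDl.
    - move=> t w a t0 [s /= s0 [<- <-]].
      by exists (t * s); rewrite /= ?mulr_ge0// rmorphM scalerA mulrA.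
  have Cq w a : C (w, a) -> a <= q w.
    move=> [t /= + [<- <-]]; rewrite le_eqVlt => /predU1P[<-|t0].
      by rewrite rmorph0 scale0r mul0r; have := sq.1 0 0; rewrite addr0; lra.
    have := sq.2 t^-1 (t%:K *: v); rewrite scalerA -rmorphM mulVf ?gt_eqF//.
    by rewrite rmorph1 scale1r invr_ge0 ltW// ler_pdivlMl// => /(_ isT).
  have sC := sublinear_cone_infimal sq cC Cq.
  have Cle w : cone_infimal q C w <= p w.
    exact: le_trans (cone_infimal_le_self sq cC Cq w) (qp w).
  have := qmin (exist _ _ (conj sC Cle)) _.
  have Cle' : le (exist _ q (conj sq qp)) (exist _ _ (conj sC Cle)).
    by apply/asboolP => w /=; exact: cone_infimal_le_self.
  move=> /(_ Cle') [/(congr1 (@^~ u))] <-.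
  have /(cone_infimal_le sq Cq u) : C (v, q v).
    by exists 1; rewrite /= ?ler01// rmorph1 scale1r mul1r.
  lra.
exists q => //; split=> // t u.
have q0 : q 0 = 0 by have := qD 0 0; rewrite addr0; lra.
have qN w : q (- w) = - q w by have := qD w (- w); rewrite subrr q0; lra.
have qZ s w : 0 <= s -> q (s%:K *: w) = s * q w.
  move=> s0; apply: le_anti; rewrite sq.2//=.
  have := sq.2 s (- w) s0; rewrite scalerN !qN; lra.
have [t0|t0] := leP 0 t; first exact: qZ.
rewrite -[t]opprK rmorphN scaleNr qN qZ ?oppr_ge0 ?ltW//; lra.
Qed.
End HahnBanach.

(** * Norming functionals and the Bishop-Phelps-Bollobas theorem *)

Section Functionals.
Context {R : realType} {K : numFieldType} (S : real_scalars R K).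
Local Notation "r %:K" := (toK S r) (at level 2, format "r %:K").
Local Notation rnorm := (real_norm S).
Local Notation obound := (obound S).

Section Complexification.
Context {X : normedModType K}.

Lemma re_linear (f : {linear X -> K^o}) : real_linear S (fun x => re S (f x)).
Proof.
split=> [u v|t u]; first by rewrite linearD reD.
by rewrite linearZ reZ.
Qed.

(** The usual formula [g x = h x - i h (i x)], which reduces to [h] when [imag] is 0. Linearity over
    [K] follows from compatibility with real scalars and with [imag], by [reE]. *)
Lemma complexification (h : X -> R) : real_linear S h ->
  exists g : {linear X -> K^o}, forall x, re S (g x) = h x.
Proof.
move=> [hD hZ]; pose J := imag S.
pose F (x : X) : K^o := (h x)%:K - J * (h (J *: x))%:K.
have FD u v : F (u + v) = F u + F v.
  by rewrite /F scalerDr !hD !rmorphD /= mulrDr; ring.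
have FZ t u : F (t%:K *: u) = t%:K * F u.
  by rewrite /F scalerA [J * t%:K]mulrC -scalerA !hZ !rmorphM /=; ring.
have h0 : h 0 = 0 by have := hD 0 0; rewrite addr0; lra.
have hN w : h (- w) = - h w by have := hD w (- w); rewrite subrr h0; lra.
have FN w : F (- w) = - F w.
  by rewrite /F scalerN !hN !rmorphN /= mulrN -opprD.
have FJ u : F (J *: u) = J * F u.
  rewrite /F scalerA /J; case: (imagM S) => JJ.
    by rewrite JJ !scale0r h0 rmorph0 !mul0r subrr.
  by rewrite mulrBr mulrA JJ scaleN1r hN rmorphN /=; ring.
have linF : linear F.
  move=> a u v; rewrite FD; congr (_ + _).
  have := reE S a; set r := re S a; set s := re S (_ * a) => ->.
  rewrite scalerBl FD FN -scalerA FJ !FZ.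
  change (r%:K * F u - J * (s%:K * F u) = (r%:K - J * s%:K) * F u); ring.
pose g : {linear X -> K^o} :=
  HB.pack_for {linear X -> K^o} F (GRing.isLinear.Build K X K^o *:%R F linF).
exists g => x; rewrite /= /F reB re_toK.
by rewrite mulrC reZ re_imag mulr0 subr0.
Qed.

Lemma obound_re (g : {linear X -> K^o}) c :
  (forall x, re S (g x) <= c * rnorm x) -> obound g c.
Proof.
move=> h x; have [a a1 ha] := rotation (g x : K).
have -> : rnorm (g x) = re S (g (a *: x)) by rewrite linearZ /real_norm -ha.
apply: le_trans (h _) _; rewrite rnormZ_norm.
have -> : rnorm (a : K^o) = 1 by rewrite /real_norm a1 re1.
by rewrite mul1r.
Qed.

(** Hahn-Banach is applied below the [cone_infimal] of [k] times the norm. The resulting functional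
    is at most [- a] at [- u], which is the required constraint. *)
Lemma mazur_orlicz k (C : set (X * R)) : 0 <= k -> convex_cone S C ->
  (forall u a, C (u, a) -> a <= k * rnorm u) ->
  exists g : {linear X -> K^o},
    obound g k /\ forall u a, C (u, a) -> a <= re S (g u).
Proof.
move=> k0 cC hC; pose p (x : X) := k * rnorm x.
have sp : sublinear S p.
  split=> [u v|t u t0]; first by rewrite /p -mulrDr ler_wpM2l// rnormD.
  by rewrite /p rnormZ// mulrCA.
have [h lh hp] := hahn_banach (sublinear_cone_infimal sp cC hC).
have [g gh] := complexification lh; exists g; split.
  apply: obound_re => x; rewrite gh; apply: le_trans (hp x) _.
  exact: (cone_infimal_le_self sp cC hC).
move=> u a Cu; have := hp (- u); have := cone_infimalN sp hC Cu.
have := lh.2 (-1) u; rewrite rmorphN1 scaleN1r gh; lra.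
Qed.

(** The only constraints are those of the ray through [(v, rnorm v)]. *)
Lemma norming_functional (v : X) :
  exists2 f : {linear X -> K^o}, obound f 1 & re S (f v) = rnorm v.
Proof.
have [||u a [t t0 [<- <-]]|f [f1 fv]] := @mazur_orlicz 1
    [set (t%:K *: v, t * rnorm v) | t in [set t | 0 <= t]]; first exact: ler01.
- split.
  + by exists 0 => //=; rewrite rmorph0 scale0r mul0r.
  + move=> u w a b [s /= s0 [<- <-]] [t /= t0 [<- <-]].
    by exists (s + t); rewrite /= ?addr_ge0// rmorphD scalerDl mulrDl.
  + move=> t w a t0 [s /= s0 [<- <-]].
    by exists (t * s); rewrite /= ?mulr_ge0// rmorphM scalerA mulrA.
- by rewrite mul1r rnormZ.
exists f => //; apply: le_anti; apply/andP; split.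
  by have := f1 v; have := re_le_rnorm S (f v); rewrite mul1r; exact: le_trans.
by apply: fv; exists 1; rewrite /= ?ler01// rmorph1 scale1r mul1r.
Qed.

End Complexification.

Section BishopPhelpsBollobas.
Context {X : completeNormedModType K}.

(** Zorn's lemma for the order [k * rnorm (v - u) <= h v - h u] on the points of the unit ball above
    [y]. Chains converge because [h] is bounded on the ball and [X] is complete. *)
Lemma bishop_phelps_point (h : X -> R) (k : R) (y : X) :
  real_linear S h -> (forall v, h v <= rnorm v) -> 0 < k -> rnorm y <= 1 ->
  exists z, [/\ rnorm z <= 1, k * rnorm (z - y) <= h z - h y &
    forall w, rnorm w <= 1 -> k * rnorm (w - z) <= h w - h z -> w = z].
Proof.
move=> [hD hZ] h1 k0 y1.
have hB u v : h (u - v) = h u - h v.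
  by have := hD (u - v) v; rewrite subrK; lra.
pose T := {w : X | rnorm w <= 1 /\ k * rnorm (w - y) <= h w - h y}.
pose leX (u v : X) := k * rnorm (v - u) <= h v - h u.
have leX_trans v u w : leX u v -> leX v w -> leX u w.
  rewrite /leX => uv vw; have := rnorm_triangle S v w u.
  by rewrite -(ler_pM2l k0) mulrDr; lra.
pose le (u v : T) := `[< leX (sval u) (sval v) >].
have y0 : rnorm y <= 1 /\ k * rnorm (y - y) <= h y - h y.
  by rewrite !subrr rnorm0 mulr0.
have [||||[z [z1 zy]] zmax] := @Zorn T le.
- by move=> u; apply/asboolP; rewrite /leX !subrr rnorm0 mulr0.
- by move=> u v w /asboolP uv /asboolP vw; apply/asboolP; exact: leX_trans vw.
- move=> [u hu] [v hv] /asboolP /= uv /asboolP /= vu; apply: eq_exist.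
  apply/eqP; rewrite -subr_eq0; apply/eqP/(@rnorm0_eq0 _ _ S).
  move: uv vu; rewrite /leX [rnorm (v - u)]rnorm_distC => uv vu.
  by rewrite -(ler_pM2l k0) mulr0; lra.
- move=> A totA; have [[a0 Aa0]|A0] := pselect (A !=set0); last first.
    by exists (exist _ y y0) => a Aa; case: A0; exists a.
  (* The tails of the chain generate a filter, whose limit is to bound the chain. *)
  pose tail (a : T) := [set sval b | b in [set b | A b /\ le a b]].
  pose F := filter_from A tail.
  have lexx' a : le a a by apply/asboolP; rewrite /leX !subrr rnorm0 mulr0.
  have le_tr b a c : le a b -> le b c -> le a c.
    by move=> /asboolP ab /asboolP bc; apply/asboolP; exact: leX_trans bc.
  have FF : ProperFilter F.
    apply: filter_from_proper; last by move=> a Aa; exists (sval a), a.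
    apply: filter_from_filter; first by exists a0.
    move=> a b Aa Ab; have [ab|ba] := totA _ _ Aa Ab.
      exists b => // _ [c [Ac bc] <-]; split; exists c => //; split=> //.
      exact: le_tr bc.
    exists a => // _ [c [Ac bc] <-]; split; exists c => //; split=> //.
    exact: le_tr bc.
  have Fcauchy : cauchy_ex F.
    move=> e e0; have e_gt0 : 0 < re S e by rewrite -(ltr_toK S) rmorph0 toK_re// ltW.
    have hs : has_sup [set h (sval a) | a in A].
      split; first by exists (h (sval a0)), a0.
      by exists 1 => _ [a _ <-]; apply: le_trans (h1 _) (svalP a).1.
    (* Beyond a point where [h] is within [k * e] of its supremum over the chain, the order keeps
       all points within [e]. *)
    have [_ [a Aa <-] ha] := sup_adherent (mulr_gt0 k0 e_gt0) hs.
    exists (sval a); exists a => // _ [b [Ab /asboolP ab] <-].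
    rewrite -ball_normE /= -(toK_re S (ltW e0)) -rnorm_lt rnorm_distC.
    rewrite -(ltr_pM2l k0); apply: le_lt_trans ab _.
    have : h (sval b) <= sup [set h (sval a) | a in A].
      by apply: (sup_upper_bound hs); exists b.
    lra.
  have [l Fl] : exists l : X, F --> l.
    by exists (lim F); exact: (cauchy_cvg F (cauchy_exP F Fcauchy)).
  have approx a e : A a -> 0 < e ->
      exists b, [/\ A b, le a b & rnorm (l - sval b) < e].
    move=> Aa e0; have : F (ball l e%:K).
      by apply: Fl; apply: nbhsx_ballx; rewrite -(rmorph0 (toK S)) ltr_toK.
    move=> [b Ab hb].
    have [c [Ac ac bc]] : exists c, [/\ A c, le a c & le b c].
      by have [ab|ba] := totA _ _ Aa Ab; [exists b|exists a].
    exists c; split => //; have /hb : tail b (sval c) by exists c.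
    by rewrite -ball_normE /= -rnorm_lt.
  have al a : A a -> leX (sval a) l.
    move=> Aa; apply/ler_addgt0Pr => e e0.
    (* The distance from [l] to [b] counts [k] times in the norm and once through [h], hence the
       division by [k + 1]. *)
    have [|b [Ab /asboolP ab lb]] := approx a (e / (k + 1)) Aa.
      by rewrite divr_gt0// addr_gt0.
    rewrite ltr_pdivlMr ?addr_gt0// mulrDr mulr1 [_ * k]mulrC in lb.
    have := rnorm_triangle S (sval b) l (sval a).
    rewrite -(ler_pM2l k0) mulrDr.
    have := h1 (sval b - l); rewrite hB [rnorm (sval b - l)]rnorm_distC.
    move: ab; rewrite /leX; lra.
  have l1 : rnorm l <= 1.
    apply/ler_addgt0Pr => e e0; have [b [_ _ lb]] := approx a0 e Aa0 e0.
    have := rnormD S (l - sval b) (sval b); rewrite subrK.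
    have := (svalP b).1; lra.
  have ly : leX y l by apply: leX_trans (al _ Aa0); exact: (svalP a0).2.
  by exists (exist _ l (conj l1 ly)) => a Aa; apply/asboolP; exact: al.
exists z; split => // w w1 zw.
have wy : leX y w by apply: leX_trans zw.
have := zmax (exist _ w (conj w1 wy)); rewrite /le /= => hz.
by have /hz[] : `[< leX z w >] by apply/asboolP.
Qed.

(** A Bishop-Phelps point [z] above [y] is nearly a maximum of [re f] on the ball. Subtracting from
    [f] a functional [g1] of norm at most [k] makes it an exact maximum, and normalising gives
    [g]. *)
Lemma bollobas (b : R) (y : X) (f : {linear X -> K^o}) :
  0 < b -> b <= 1 -> rnorm y <= 1 -> obound f 1 -> 1 - b ^+ 2 / 8 < re S (f y) ->
  exists z (g : {linear X -> K^o}),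
    [/\ states (z, g), rnorm (y - z) < b & obound (f \- g) b].
Proof.
(* With [d = k * b / 2 = b ^+ 2 / 8], the point moves by less than [d / k = b / 2], and the
   functional by at most [2 * k + d <= b]. *)
move=> b0 b1 y1 f1; pose k := b / 4; pose d := k * b / 2.
have k0 : 0 < k by rewrite divr_gt0.
have d0 : 0 < d by rewrite !mulr_gt0// invr_gt0.
have db : d <= b / 8 by rewrite /d /k; nra.
have -> : b ^+ 2 / 8 = d by rewrite /d /k; field.
move=> fy.
have hf := re_linear f.
have fle v : re S (f v) <= rnorm v.
  by have := f1 v; rewrite mul1r; apply: le_trans; exact: re_le_rnorm.
have [z [z1 zy zmax]] := bishop_phelps_point hf fle k0 y1.
pose f0 v := re S (f v).
have [f0D f0Z] : real_linear S f0 by [].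
have fB u v : f0 (u - v) = f0 u - f0 v by rewrite /f0 linearB reB.
have max1 w : rnorm w <= 1 -> f0 (w - z) <= k * rnorm (w - z).
  move=> w1; rewrite leNgt; apply/negP => hw.
  have wz : w = z by apply: zmax => //; apply: le_trans (ltW hw) _; rewrite fB.
  by move: hw; rewrite wz subrr rnorm0 mulr0 /f0 linear0 re0 ltxx.
(* The cone of directions pointing from [z] into the unit ball, each with the constraint
   [f0 <= re g1]. Compatibility with [k] times the norm is [max1]. *)
pose C := [set p | exists u t, rnorm u <= t /\
  p = (u - t%:K *: z, f0 (u - t%:K *: z))].
have [|||g1 [g1k Cg1]] := @mazur_orlicz X k C.
- exact: ltW.
- split.
  + by exists 0, 0; rewrite rnorm0 rmorph0 scale0r subrr /f0 linear0 re0.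
  + move=> _ _ _ _ [u [s [us [-> ->]]]] [v [t [vt [-> ->]]]].
    exists (u + v), (s + t); split.
      by apply: le_trans (rnormD _ _ _) _; exact: lerD.
    have <- : u - s%:K *: z + (v - t%:K *: z) = u + v - (s + t)%:K *: z.
      by rewrite rmorphD scalerDl opprD addrACA.
    by rewrite [in RHS]f0D.
  + move=> r _ _ r0 [u [t [ut [-> ->]]]]; exists (r%:K *: u), (r * t); split.
      by rewrite rnormZ// ler_wpM2l.
    have <- : r%:K *: (u - t%:K *: z) = r%:K *: u - (r * t)%:K *: z.
      by rewrite rmorphM -scalerA -scalerBr.
    by rewrite f0Z.
- move=> _ _ [u [t [ut [-> ->]]]].
  have := rnorm_ge0 S u; move=> /le_trans/(_ ut).
  rewrite le_eqVlt => /predU1P[t0|t0].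
    move: ut; rewrite -t0 => /rnorm0_eq0 ->.
    by rewrite rmorph0 scale0r subrr rnorm0 mulr0 /f0 linear0 re0.
  have -> : u - t%:K *: z = t%:K *: (t^-1%:K *: u - z).
    by rewrite scalerBr scalerA -rmorphM divff ?gt_eqF// rmorph1 scale1r.
  have t0' := ltW t0; rewrite f0Z rnormZ// [k * _]mulrCA ler_pM2l//; apply: max1.
  by rewrite rnormZ ?invr_ge0// ler_pdivrMl// mulr1.
pose g0 : {linear X -> K^o} := f \- g1.
pose G := re S (g0 z).
have re_g1 v : - (k * rnorm v) <= re S (g1 v) <= k * rnorm v.
  have := le_trans (re_le_rnorm S (g1 v)) (g1k v).
  have := le_trans (re_le_rnorm S (g1 (- v))) (g1k (- v)).
  by rewrite rnormN linearN reN; lra.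
(* The vector [u - (rnorm u)%:K *: z] is in the cone, so the real part of [g0] is nonpositive
   there. *)
have g0u u : re S (g0 u) <= G * rnorm u.
  have /Cg1 : C (u - (rnorm u)%:K *: z, f0 (u - (rnorm u)%:K *: z)).
    by exists u, (rnorm u).
  have g1Z t w : re S (g1 (t%:K *: w)) = t * re S (g1 w) := (re_linear g1).2 t w.
  rewrite fB f0Z linearB reB g1Z /G /g0 /= !reB /f0; lra.
have Gb : 1 - d - k < G <= 1 + k.
  rewrite /G /g0 /= reB; have := fle z; have := re_g1 z.
  have := rnorm_ge0 S z; have : k * rnorm z <= k by rewrite ger_pMr.
  have := zy; have := mulr_ge0 (ltW k0) (rnorm_ge0 S (z - y)).
  lra.
have G0 : 0 < G by have /andP[] := Gb; rewrite /k; lra.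
have z1' : rnorm z = 1.
  apply: le_anti; rewrite z1/=; have := g0u z; rewrite -/G.
  by rewrite -{1}[G]mulr1 ler_pM2l.
pose g : {linear X -> K^o} := G^-1%:K \*: g0.
have g0b := obound_re g0u.
have gb : obound g 1.
  move=> u; rewrite /g /= rnormZ ?invr_ge0 ?(ltW G0)// mul1r ler_pdivrMl//.
  exact: g0b.
exists z, g; split.
(* A scalar of modulus at most 1 and real part 1 equals 1. *)
- apply/(statesP S); split => //.
  have rg : re S (g z) = 1.
    by rewrite /g /= reZ -/G mulVf ?gt_eqF.
  have ng : re S `|g z| = 1.
    apply: le_anti; rewrite -{2}rg re_le_norm andbT.
    by have := gb z; rewrite z1' mulr1.
  by rewrite (re_eq_norm (etrans rg (esym ng))) -(toK_norm S) ng rmorph1.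
- rewrite rnorm_distC -(ltr_pM2l k0); apply: le_lt_trans zy _.
  have := fle z; rewrite /d in fy *; have := mulr_gt0 k0 b0; lra.
- move=> u; have -> : (f \- g) u = g1 u + (1 - G^-1)%:K *: g0 u.
    rewrite /g /g0 /= rmorphB rmorph1 scalerBl scale1r.
    by rewrite addrA [g1 u + _]addrC subrK.
  apply: le_trans (rnormD _ _ _) _; rewrite rnormZ_norm rnorm_toK.
  have h2 : `|1 - G^-1| * G <= k + d.
    rewrite -{2}(gtr0_norm G0) -normrM mulrBl mul1r mulVf ?gt_eqF//.
    by rewrite ler_norml; have /andP[] := Gb; lra.
  have h3 : `|1 - G^-1| * rnorm (g0 u) <= (k + d) * rnorm u.
    apply: le_trans (ler_wpM2l (normr_ge0 _) (g0b u)) _.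
    by rewrite mulrA ler_wpM2r ?rnorm_ge0.
  have := g1k u; have := rnorm_ge0 S u; move: h3; rewrite /k; nra.
Qed.

End BishopPhelpsBollobas.
End Functionals.

(** * Finite approximation of a compact operator *)

Section CompactApproximation.
Context {R : realType} {K : numFieldType} (S : real_scalars R K).
Local Notation "r %:K" := (toK S r) (at level 2, format "r %:K").
Local Notation rnorm := (real_norm S).
Local Notation obound := (obound S).
Context {X : normedModType K}.

(** The interval from [- L] to [L] is cut into cells of length [r], and the code is the number of
    the cell. *)
Lemma real_coding (L r : R) : 0 < r -> exists (n : nat) (c : R -> 'I_n.+1),
  forall a b, `|a| <= L -> `|b| <= L -> c a = c b -> `|a - b| <= r.
Proof.
move=> r0; pose t a := Num.truncn ((a + L) / r); pose n := t L.
have tP a : `|a| <= L -> (t a)%:R <= (a + L) / r < (t a).+1%:R.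
  move=> aL; apply: truncn_itv.
  by rewrite divr_ge0// ?(ltW r0)//; move: aL; rewrite ler_norml; lra.
have tn a : `|a| <= L -> (t a < n.+1)%N.
  move=> aL; rewrite ltnS; apply: le_truncn; rewrite ler_pM2r ?invr_gt0// lerD2r.
  exact: le_trans (ler_norm a) aL.
exists n, (fun a => inord (t a)) => a b aL bL /(congr1 val).
rewrite /= !inordK ?tn// => tab.
have := tP _ aL; have := tP _ bL; rewrite tab -!natr1.
rewrite !ler_pdivlMr// !ltr_pdivrMr// !mulrDl mul1r ler_norml; lra.
Qed.

Lemma rnorm_imag : rnorm (imag S : K^o) <= 1.
Proof.
case: (imagM S) => [->|JJ]; first by rewrite rnorm0.
have : rnorm (imag S : K^o) * rnorm (imag S : K^o) = 1.
  by rewrite -rnormZ_norm [_ *: _]JJ rnormN rnorm1.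
by have := rnorm_ge0 S (imag S : K^o); nra.
Qed.

Lemma rnorm_le_re_imag (a : K^o) : rnorm a <= `|re S a| + `|re S (imag S * a)|.
Proof.
rewrite {1}(reE S a); apply: le_trans (rnormB _ (_ : K^o) _) _.
rewrite rnorm_toK lerD2l [rnorm _](@rnormZ_norm _ _ S K^o) rnorm_toK.
by apply: ler_piMl; [exact: normr_ge0|exact: rnorm_imag].
Qed.

(** On a finite set, functionals of norm at most 1 are told apart up to [r] by finitely many codes:
    for each [y], the cells of the real parts of [f y] and [f (imag S *: y)], of length [r / 2]
    each. *)
Lemma dual_ball_coding (s : seq X) (r : R) : 0 < r ->
  exists (I : finType) (c : {linear X -> K^o} -> I),
    forall f g : {linear X -> K^o}, obound f 1 -> obound g 1 -> c f = c g ->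
      forall y, y \in s -> rnorm (f y - g y) <= r.
Proof.
move=> r0; elim: s => [|y s [I [c hc]]]; first by exists unit, (fun=> tt).
have r2 : 0 < r / 2 by rewrite divr_gt0.
have [n [d hd]] := real_coding (rnorm y) r2.
pose c' (f : {linear X -> K^o}) := (d (re S (f y)), d (re S (f (imag S *: y))), c f).
exists ('I_n.+1 * 'I_n.+1 * I)%type, c' => f g f1 g1.
move=> [] /hd c1 /hd c2 /(hc _ _ f1 g1) c3 z.
have fle (h : {linear X -> K^o}) : obound h 1 -> forall v, `|re S (h v)| <= rnorm v.
  move=> h1 v; have := le_trans (re_le_rnorm S (h v)) (h1 v).
  have := le_trans (re_le_rnorm S (h (- v))) (h1 (- v)).
  by rewrite rnormN linearN reN ler_norml; lra.
have fb (h : {linear X -> K^o}) : obound h 1 -> `|re S (h (imag S *: y))| <= rnorm y.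
  move=> h1; apply: le_trans (fle h h1 _) _; rewrite rnormZ_norm.
  by apply: ler_piMl; [exact: (rnorm_ge0 S)|exact: rnorm_imag].
rewrite inE => /predU1P[->|/c3//].
apply: le_trans (rnorm_le_re_imag _) _.
rewrite reB mulrBr reB [r in _ <= r]splitr lerD//.
  by apply: c1; exact: fle.
have := c2 (fb _ f1) (fb _ g1); rewrite !linearZ; exact.
Qed.

Lemma dual_ball_net (s : seq X) (r : R) : 0 < r ->
  exists (n : nat) (g : 'I_n.+1 -> {linear X -> K^o}),
    (forall i, obound (g i) 1) /\
    forall f : {linear X -> K^o}, obound f 1 ->
      exists i, forall y, y \in s -> rnorm (f y - g i y) <= r.
Proof.
move=> r0; have [I [c hc]] := dual_ball_coding s r0.
(* The zero functional represents the codes that no functional of the dual ball takes. *)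
pose f0 : {linear X -> K^o} := \0.
have f01 : obound f0 1 by move=> x; rewrite /f0 /= rnorm0 mul1r rnorm_ge0.
have rep i : exists g : {linear X -> K^o}, obound g 1 /\
      forall f : {linear X -> K^o}, obound f 1 -> c f = i -> c g = i.
  have [[f [f1 cf]]|no] := pselect (exists f : {linear X -> K^o}, obound f 1 /\ c f = i).
    by exists f.
  by exists f0; split => // f f1 cf; case: no; exists f.
have [g hg] := choice rep.
(* The spare index keeps the family nonempty even if [I] is empty; there [nth] falls back on the
   code of [f0]. *)
exists #|I|, (fun i => g (nth (c f0) (enum I) i)); split=> [i|f f1].
  exact: (hg _).1.
have hi : (index (c f) (enum I) < #|I|.+1)%N.
  by rewrite ltnS cardE index_size.
exists (Ordinal hi) => y ys; rewrite /= nth_index ?mem_enum//.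
apply: hc => //; first exact: (hg _).1.
by rewrite ((hg (c f)).2 f f1).
Qed.

Lemma precompact_net (A : set X) (r : R) : 0 < r -> precompact A ->
  exists s : seq X, forall a, A a -> exists2 y, y \in s & rnorm (a - y) < r.
Proof.
move=> r0 [B AB [+ _]]; rewrite compact_cover => cB.
have rK : 0 < r%:K by rewrite -(rmorph0 (toK S)) ltr_toK.
have [||D _ hD] := cB X setT (fun y => ball y r%:K).
- by move=> y _; exact: ball_open.
- by move=> x _; exists x => //; exact: ballxx.
exists (finmap.enum_fset D) => a /AB/hD[y /= yD ay]; exists y => //.
by rewrite rnorm_distC rnorm_lt; move: ay; rewrite -ball_normE.
Qed.

Lemma seq_rnorm_bound (s : seq X) : exists2 L, 1 <= L & forall y, y \in s -> rnorm y <= L.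
Proof.
elim: s => [|y s [L L1 hL]]; first by exists 1.
exists (Num.max L (rnorm y)); first by rewrite le_max L1.
by move=> z; rewrite inE le_max => /predU1P[->|/hL ->//]; rewrite lexx orbT.
Qed.

Lemma obound_ball (Y : normedModType K) (T : {linear X -> Y}) c :
  (forall x, rnorm x <= 1 -> rnorm (T x) <= c) -> obound T c.
Proof.
move=> h x; have [x0|x0] := leP (rnorm x) 0.
  by rewrite (rnorm0_eq0 x0) linear0 !rnorm0 mulr0.
have xV : 0 <= (rnorm x)^-1 by rewrite invr_ge0 ltW.
have := h ((rnorm x)^-1%:K *: x); rewrite linearZ !rnormZ// mulVf ?gt_eqF//.
by move=> /(_ (lexx _)); rewrite mulrC ler_pdivrMr.
Qed.

(** The difference is [(P T - T) P + (T P - T)]. The first term is controlled on a finite net of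
    [T(B_X)]. The second is controlled, as in Schauder's theorem, by finitely many functionals
    [g i \o T], since [T(B_X)] is totally bounded. *)
Lemma compact_operator_approx (T : {linear X -> X}) e : compact_operator T -> 0 < e ->
  exists (d : R) (n m : nat) (f : 'I_n.+1 -> {linear X -> K^o}) (x : 'I_m.+1 -> X),
  [/\ 0 < d, forall i, obound (f i) 1, forall j, rnorm (x j) <= 1 &
   forall P : {linear X -> X}, obound P 1 ->
     (forall i, obound ((f i \o P) \- f i) d) ->
     (forall j, rnorm (P (x j) - x j) <= d) -> obound ((P \o T \o P) \- T) e].
Proof.
move=> [cT pT] e0; have [M0 M00 hM0] := continuous_obound S cT.
pose M := M0 + 1.
have M_gt0 : 0 < M by rewrite ltr_wpDl.
have TM : obound T M by move=> u; have := hM0 u; have := rnorm_ge0 S u; rewrite /M mulrDl; lra.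
(* The two terms cost [2 * r + L * d] and [6 * r + M * d]; these values of [r] and [d] make the sum
   [e]. *)
pose r := e / 16; have r0 : 0 < r by rewrite divr_gt0.
have [s hs] := precompact_net r0 pT.
have [L L1 hL] := seq_rnorm_bound s.
have L0 : 0 < L by apply: lt_le_trans L1.
have [n [g [g1 hg]]] := dual_ball_net s r0.
pose d := e / (2 * (L + M)).
have d0 : 0 < d by rewrite divr_gt0// mulr_gt0// addr_gt0.
(* Division by [M] and [L] brings the functionals and the points into the unit balls. The last index
   yields the default point 0. *)
exists d, n, (size s), (fun i => M^-1%:K \*: (g i \o T)),
  (fun j => L^-1%:K *: nth 0 s j); split => //.
- move=> i u /=; rewrite rnormZ ?invr_ge0 ?(ltW M_gt0)//.
  by rewrite mul1r ler_pdivrMl//; have := g1 i (T u); have := TM u; lra.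
- move=> j; rewrite rnormZ ?invr_ge0 ?(ltW L0)// ler_pdivrMl// mulr1.
  have [js|js] := ltnP j (size s); first by apply: hL; exact: mem_nth.
  by rewrite nth_default// rnorm0 ltW.
move=> P P1 hf hx; apply: obound_ball => u u1 /=.
have Pb v : rnorm v <= 1 -> rnorm (P v) <= 1.
  by move=> v1; have := P1 v; rewrite mul1r => /le_trans; apply.
have Py y : y \in s -> rnorm (P y - y) <= L * d.
  move=> /(nthP 0)[j js <-].
  have js' : (j < (size s).+1)%N by rewrite ltnW.
  have := hx (Ordinal js'); rewrite /= linearZ -scalerBr rnormZ ?invr_ge0 ?(ltW L0)//.
  by rewrite ler_pdivrMl.
have PT v : rnorm v <= 1 -> rnorm (P (T v) - T v) <= 2 * r + L * d.
  move=> v1; have [|y ys yT] := hs (T v).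
    by exists v => //=; rewrite -(rmorph1 (toK S)) -rnorm_le.
  have := rnorm_triangle S (P y) (P (T v)) (T v).
  have := rnorm_triangle S y (P y) (T v).
  have := P1 (T v - y); rewrite linearB mul1r.
  have := Py y ys; rewrite (rnorm_distC S y); lra.
have TP : rnorm (T (P u) - T u) <= 6 * r + M * d.
  (* A norming functional [f] is replaced by a member [g i] of the net, at a cost of [3 * r] at each
     of the two points. *)
  have [f f1 <-] := norming_functional S (T (P u) - T u).
  have [i hi] := hg f f1.
  have fg v : rnorm v <= 1 -> rnorm (f (T v) - g i (T v)) <= 3 * r.
    move=> v1; have [|y ys yT] := hs (T v).
      by exists v => //=; rewrite -(rmorph1 (toK S)) -rnorm_le.
    have := rnorm_triangle S (f y) (f (T v)) (g i (T v)).
    have := rnorm_triangle S (g i y) (f y) (g i (T v)).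
    have := f1 (T v - y); rewrite linearB mul1r.
    have := g1 i (T v - y); rewrite linearB mul1r.
    by have := hi y ys; rewrite (rnorm_distC S (g i y)); lra.
  have := re_le_rnorm S (f (T (P u) - T u)); rewrite linearB.
  have := rnorm_triangle S (g i (T (P u))) (f (T (P u))) (f (T u)).
  have := rnorm_triangle S (g i (T u)) (g i (T (P u))) (f (T u)).
  have := fg _ (Pb u u1); have := fg u u1; rewrite (rnorm_distC S (f (T u))).
  have := hf i u; rewrite /= -scalerBr rnormZ ?invr_ge0 ?(ltW M_gt0)// ler_pdivrMl//.
  have : M * (d * rnorm u) <= M * d by rewrite ler_pM2l// ger_pMr.
  lra.
have := rnorm_triangle S (T (P u)) (P (T (P u))) (T u).
have := PT _ (Pb u u1).
have -> : e = 8 * r + (L + M) * d.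
  by rewrite /r /d; field; rewrite gt_eqF// addr_gt0.
lra.
Qed.

End CompactApproximation.

(** * Numerical radius and retracts *)

Section NumericalRadiusTheory.
Context {R : realType} {K : numFieldType} (S : real_scalars R K).
Local Notation "r %:K" := (toK S r) (at level 2, format "r %:K").
Local Notation rnorm := (real_norm S).
Local Notation obound := (obound S).

Lemma numerical_radius_ge0 (X : normedModType K) (T : X -> X) c :
  obound T c -> 0 <= numerical_radius T.
Proof.
move=> hT; have [[[x f] xf]|no] := pselect (@states K X !=set0).
  by apply: le_trans (numerical_radius_ge hT xf).
rewrite /numerical_radius /supremum; case: ifPn => // /set0P[_ [u xu _]].
by case: no; exists u.
Qed.

Lemma numerical_radius_normalized (X : normedModType K) (T : {linear X -> X}) c r :
  obound T c -> 0 < r -> numerical_radius T = r%:K ->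
  numerical_radius (r^-1%:K \*: T) = 1.
Proof.
move=> hT r0 nT; have rV : 0 <= r^-1 by rewrite invr_ge0 ltW.
have hT' : obound (r^-1%:K \*: T) (r^-1 * c).
  by move=> x /=; rewrite rnormZ// -mulrA ler_wpM2l.
have nr x f : states (x, f) -> rnorm (f (T x)) <= r.
  by move=> xf; rewrite -(ler_toK S) toK_rnorm -nT; exact: numerical_radius_ge hT xf.
apply: le_anti; apply/andP; split.
  rewrite -(rmorph1 (toK S)); apply: numerical_radius_le => // x f xf /=.
  by rewrite linearZ rnormZ// ler_pdivrMl// mulr1; exact: nr xf.
have s0 := numerical_radius_ge0 hT'.
rewrite -(toK_re S s0) -(rmorph1 (toK S)) ler_toK -(ler_pM2l r0) mulr1.
rewrite -(ler_toK S) -nT; apply: numerical_radius_le => [|x f xf].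
  by rewrite mulr_ge0 ?(ltW r0)// -(toK_ge0 S) toK_re.
have := numerical_radius_ge hT' xf; rewrite -(toK_re S s0) /= linearZ -rnorm_le.
by rewrite rnormZ// ler_pdivrMl// re_toK.
Qed.

End NumericalRadiusTheory.

Section Retract.
Context {R : realType} {K : numFieldType} (S : real_scalars R K).
Local Notation "r %:K" := (toK S r) (at level 2, format "r %:K").
Local Notation rnorm := (real_norm S).
Local Notation obound := (obound S).
Context {X Y : normedModType K} (Q : {linear X -> Y}) (i : {linear Y -> X}).
Hypotheses (Q1 : obound Q 1) (i1 : obound i 1) (Qi : forall y, Q (i y) = y).

(** Both maps are contractions and [Q \o i] is the identity, so [i] preserves norms. *)
Lemma states_retract y (g : {linear Y -> K^o}) :
  states (y, g) -> states (i y, (g \o Q : {linear X -> K^o})).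
Proof.
move=> /(statesP S)[y1 g1 gy]; apply/(statesP S); split.
- apply: le_anti; rewrite -{1}y1 -[rnorm y]mul1r i1/=.
  by have := Q1 (i y); rewrite Qi y1 mul1r.
- by rewrite -[1]mulr1; apply: obound_comp => //; exact: ler01.
- by rewrite /= Qi.
Qed.

Lemma numerical_radius_compression (T : {linear X -> X}) c : obound T c -> 0 <= c ->
  numerical_radius (Q \o T \o i) <= numerical_radius T.
Proof.
move=> hT c0; have n0 := numerical_radius_ge0 hT.
rewrite -(toK_re S n0); apply: numerical_radius_le.
  by rewrite -(toK_ge0 S) toK_re.
move=> y g /states_retract yg; have := numerical_radius_ge hT yg.
by rewrite rnorm_le toK_re.
Qed.

(* If the norm of x only depends on the norms of i (Q x) and of x - i (Q x), then
   i (Q x) can be replaced by any i u of the same norm, so the functional f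
   attains its norm on the range of i at i (Q x). *)
Lemma numerical_radius_absolute (T : {linear Y -> Y}) : absolute_projection (i \o Q) ->
  natural_inclusion i -> (forall y g, states (y, g) -> rnorm (g (T y)) <= 1) ->
  forall x f, states (x, f) -> rnorm (f (i (T (Q x)))) <= 1.
Proof.
move=> [_ [N _ hN]] ii hT x f /(statesP S)[x1 f1 fx].
pose A := re S (f (i (Q x))).
have iN y : rnorm (i y) = rnorm y by rewrite /real_norm ii.
have A1 : A <= 1.
  apply: le_trans (re_le_rnorm S _) _; apply: le_trans (f1 _) _.
  rewrite mul1r iN; apply: le_trans (Q1 _) _; rewrite x1 mulr1//.
have swap u : rnorm u = rnorm (Q x) -> re S (f (i u)) <= A.
  move=> uQ; set w := i u + (x - i (Q x)).
  have iQw : i (Q w) = i u by rewrite /w linearD linearB !Qi subrr addr0.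
  have w1 : rnorm w = 1.
    rewrite -x1 /real_norm hN [in RHS]hN /= iQw /w addrAC subrr add0r !ii.
    by rewrite -!(toK_rnorm S) uQ.
  have := f1 w; rewrite w1 mulr1 => /(le_trans (re_le_rnorm S _)).
  by rewrite /w linearD linearB reD reB fx re1 /A; lra.
have [a0|a_gt0] := leP (rnorm (Q x)) 0.
  by rewrite (rnorm0_eq0 a0) !linear0 rnorm0 ler01.
pose a := rnorm (Q x); rewrite -/a in a_gt0.
pose q := A / a.
pose g : {linear Y -> K^o} := f \o i.
have gq : obound g q.
  apply: obound_re => u; rewrite /g /q /=.
  have [u0|u0] := leP (rnorm u) 0.
    by rewrite (rnorm0_eq0 u0) !linear0 rnorm0 re0 mulr0.
  have r0 : 0 < a / rnorm u by rewrite divr_gt0.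
  have := swap ((a / rnorm u)%:K *: u).
  rewrite rnormZ ?(ltW r0)// divfK ?gt_eqF// => /(_ erefl).
  have [_ gZ] := re_linear S g; have := gZ (a / rnorm u) u; rewrite /g /= => ->.
  by rewrite mulrAC ler_pdivrMr// mulrAC ler_pdivlMr// mulrC.
have A0 : 0 <= A.
  have := le_trans (rnorm_ge0 S _) (gq (Q x)); rewrite /q -/a divfK ?gt_eqF//.
(* If [A] is not positive, the bound [q] of [g] is not either, and the value to estimate is at most
   0. *)
have [A_le0|A_gt0] := leP A 0.
  have q0 : q <= 0 by rewrite /q ler_pdivrMr// mul0r.
  apply: le_trans (gq (T (Q x))) _.
  apply: le_trans (ler01); rewrite mulr_le0_ge0// rnorm_ge0//.
have q0 : 0 < q by rewrite divr_gt0.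
have aV : 0 <= a^-1 by rewrite invr_ge0 ltW.
have qV : 0 <= q^-1 by rewrite invr_ge0 ltW.
have gQ : rnorm (g (Q x)) = A.
  apply: le_anti; apply/andP; split; last exact: re_le_rnorm.
  by have := gq (Q x); rewrite /q -/a divfK ?gt_eqF.
(* Since [g (Q x) = A = q * a], normalising both entries gives a state of [Y]. The value of [T] at
   it is [f (i (T (Q x)))] divided by [q * a], so the bound is [A <= 1]. *)
have st : states (a^-1%:K *: Q x, (q^-1%:K \*: g : {linear Y -> K^o})).
  apply/(statesP S); split.
  - by rewrite rnormZ// mulVf ?gt_eqF.
  - by move=> u /=; rewrite rnormZ// ler_pdivrMl// mul1r; exact: gq.
  - have gQA : g (Q x) = A%:K.
      by rewrite (re_eq_norm (esym gQ : re S (g (Q x)) = _)) -gQ toK_rnorm.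
    have := linearZ_LR g a^-1%:K (Q x); rewrite gQA => gZ.
    change (q^-1%:K * g (a^-1%:K *: Q x) = 1); rewrite gZ.
    change (q^-1%:K * (a^-1%:K * A%:K) = 1).
    rewrite -!rmorphM -(rmorph1 (toK S)); congr (toK S _).
    by rewrite /q; field; rewrite !gt_eqF.
have := hT _ _ st.
rewrite [X in rnorm X](_ : _ = q^-1%:K *: (a^-1%:K *: (f (i (T (Q x))) : K^o))); last first.
  by rewrite /= (linearZ_LR T) (linearZ_LR i) (linearZ_LR f).
rewrite !rnormZ// ler_pdivrMl// ler_pdivrMl// mulr1 mulrC /q divfK ?gt_eqF// => h.
exact: le_trans h A1.
Qed.

End Retract.

(** * Transfer of the Bishop-Phelps-Bollobas property from the retracts to [X] *)

Theorem lemma2p1 (R : realType) (K : numFieldType)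
  (hK : K = R :> numFieldType \/ K = R[i] :> numFieldType)
  (X : completeNormedModType K)
  (hX : 0 < compact_numerical_index X)
  (eta : K -> K)
  (heta : forall eps : K, 0 < eps < 1 -> 0 < eta eps < 1)
  (hP : forall (delta : K), 0 < delta ->
    forall (n l : nat) (xs : 'I_n.+1 -> {linear X -> K^o}) (x : 'I_l.+1 -> X),
      (forall j, dual_ball (xs j)) -> (forall j, `|x j| <= 1) ->
    exists (Y : completeNormedModType K)
           (Pt : {linear X -> Y}) (i : {linear Y -> X}),
      [/\ continuous Pt, continuous i, opnorm Pt = 1, opnorm i = 1 &
          range Pt = setT] /\
      let P := i \o Pt in
      [/\ forall j, opnorm ((xs j \o P) \- xs j) < delta,
          forall j, `|P (x j) - x j| < delta,
          Pt \o i = id,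
          BPBp_nu_compact_with Y eta &
          (absolute_projection P /\ natural_inclusion i) \/
          (compact_numerical_index Y = compact_numerical_index X /\
           compact_numerical_index X = 1)]) :
  BPBp_nu_compact X.
Proof.
have [S] := real_scalars_of hK.
pose n0 := re S (compact_numerical_index X).
have n0E : compact_numerical_index X = toK S n0 by rewrite toK_re// ltW.
have n0_gt0 : 0 < n0 by rewrite -(ltr_toK S) -n0E rmorph0.
move=> eps /andP[eps0 eps1]; pose e := re S eps.
have eE : eps = toK S e by rewrite toK_re// ltW.
have e0 : 0 < e by rewrite -(ltr_toK S) -eE rmorph0.
have e1 : e < 1 by rewrite -(ltr_toK S) -eE rmorph1.
pose e4 := e / 4.
have e40 : 0 < e4 by rewrite divr_gt0.
have e4K : 0 < toK S e4 < 1.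
  by rewrite -(rmorph0 (toK S)) -(rmorph1 (toK S)) !ltr_toK /e4; lra.
have /andP[h0 h1] := heta _ e4K.
pose h := re S (eta (toK S e4)).
have hE : eta (toK S e4) = toK S h by rewrite toK_re// ltW.
have h_gt0 : 0 < h by rewrite -(ltr_toK S) -hE rmorph0.
(* The bound [h] allows the property of [Y] to be used at [e / 4]. The two others give [1 / 2 < nu]
   and [(nu^-1 - 1) / n0 <= 2 * h' / n0 <= e / 8] for the radius [nu] of the compression. *)
pose h' := Num.min h (Num.min (1 / 2) (n0 * e / 16)).
have h'0 : 0 < h' by rewrite !lt_min h_gt0 !divr_gt0// mulr_gt0.
have h'h : h' <= h by rewrite ge_min lexx.
have h'2 : h' <= 1 / 2 by rewrite !ge_min lexx orbT.
have h'n : h' <= n0 * e / 16 by rewrite !ge_min lexx !orbT.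
have h'K : 0 < toK S h' < 1.
  by rewrite -(rmorph0 (toK S)) -(rmorph1 (toK S)) !ltr_toK h'0/=; lra.
exists (toK S h') => //.
move=> T x f cT xf nuT fTx.
have hTx : 1 - h' < real_norm S (f (T x) : K^o).
  by rewrite -(ltr_toK S) toK_rnorm rmorphB rmorph1.
pose M := n0^-1.
have M0 : 0 < M by rewrite invr_gt0.
have [c c0 Tc] := continuous_obound S cT.1.
have TM : obound S T M.
  apply: (compact_numerical_index_le n0_gt0 (ltW M0) n0E cT) => z g zg.
  rewrite mulfV ?gt_eqF// rnorm_le rmorph1 -nuT; exact: numerical_radius_ge Tc zg.
pose gap := real_norm S (f (T x) : K^o) - (1 - h').
have gap0 : 0 < gap by rewrite subr_gt0.
(* Passing from [T] at [(x, f)] to the compression at a state of [Y] loses at most [e2 + 2 * b * M].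
   The choices of [e2] and [b] keep this below [gap]; the [M + 1] in [b] makes it strict. *)
pose e2 := Num.min (e / 8) (gap / 3).
have e20 : 0 < e2 by rewrite lt_min !divr_gt0.
have e2e : e2 <= e / 8 by rewrite ge_min lexx.
have e2g : e2 <= gap / 3 by rewrite ge_min lexx orbT.
pose b := Num.min e4 (gap / (3 * (M + 1))).
have M10 : 0 < 3 * (M + 1) by rewrite mulr_gt0// addr_gt0.
have b0 : 0 < b by rewrite lt_min !divr_gt0.
have be : b <= e4 by rewrite ge_min lexx.
have bg : b * (3 * (M + 1)) <= gap by rewrite -ler_pdivlMr// ge_min lexx orbT.
have b1 : b <= 1 by apply: le_trans be _; move: e1; rewrite /e4; clear; lra.
have [d1 [n [m [F [xx [d10 F1 xx1 hd1]]]]]] := compact_operator_approx S cT e20.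
case/(statesP S): (xf) => x1 f1 fx.
(* The three bounds serve the approximation of [T], the Bishop-Phelps-Bollobas theorem and the final
   distances. *)
pose d := Num.min d1 (Num.min (b ^+ 2 / 8) e4).
have d0 : 0 < d by rewrite !lt_min d10 /= !divr_gt0// exprn_gt0.
have dd1 : d <= d1 by rewrite ge_min lexx.
have db : d <= b ^+ 2 / 8 by rewrite !ge_min lexx orbT.
have de : d <= e4 by rewrite !ge_min lexx !orbT.
(* Index 0 adds [f] and [x] to the families required for [T], so that [P] nearly fixes them as
   well. *)
pose fs (j : 'I_n.+2) := if unlift ord0 j is Some j' then F j' else f.
pose ps (j : 'I_m.+2) := if unlift ord0 j is Some j' then xx j' else x.
have [|||Y [Q [i [[cQ ci Q1' i1' _] [hf hx Qi bpb alt]]]]] := hP (toK S d) _ n.+1 m.+1 fs ps.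
- by rewrite -(rmorph0 (toK S)) ltr_toK.
- by move=> j; apply/(dual_ballP S); rewrite /fs; case: (unlift ord0 j) => [j'|] //; exact: F1.
- move=> j; rewrite -(rmorph1 (toK S)) -rnorm_le /ps.
  by case: (unlift ord0 j) => [j'|]; rewrite ?x1.
have Q1 : obound S Q 1 by apply: opnorm_obound => //; rewrite Q1' rmorph1.
have i1 : obound S i 1 by apply: opnorm_obound => //; rewrite i1' rmorph1.
have Qi' y : Q (i y) = y by have := congr1 (@^~ y) Qi.
pose P : {linear X -> X} := i \o Q.
have P1 : obound S P 1 by rewrite -[1]mulr1; apply: obound_comp => //; exact: ler01.
have fsP j : obound S ((fs j \o P) \- fs j) d.
  apply: opnorm_obound; last exact: ltW (hf j).
  (* The crude bound 2 supplies the continuity under which [opnorm] is a pointwise bound. *)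
  apply: (@obound_continuous _ _ S _ _ _ (1 + 1)) => u /=.
  have fs1 : obound S (fs j) 1.
    by rewrite /fs; case: (unlift ord0 j) => [j'|] //; exact: F1.
  have := rnormB S (fs j (P u) : K^o) (fs j u).
  by have := fs1 u; have := fs1 (P u); have := P1 u; clear; lra.
have psP j : real_norm S (P (ps j) - ps j) < d by rewrite rnorm_lt; exact: hx.
have fP u : real_norm S (f (P u) - f u : K^o) <= d * real_norm S u.
  by have := fsP ord0 u; rewrite /fs unlift_none.
have xP : real_norm S (P x - x) < d by have := psP ord0; rewrite /ps unlift_none.
have PTP : obound S ((P \o T \o P) \- T) e2.
  apply: hd1 => // j.
    move=> u; have := fsP (lift ord0 j) u; rewrite /fs liftK.
    by move=> /le_trans; apply; rewrite ler_wpM2r ?rnorm_ge0.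
  by have := psP (lift ord0 j); rewrite /ps liftK => /ltW/le_trans; apply.
pose T0 : {linear Y -> Y} := Q \o T \o i.
have T0M : obound S T0 M.
  move=> y; apply: le_trans (Q1 _) _; rewrite mul1r; apply: le_trans (TM _) _.
  by rewrite ler_wpM2l ?(ltW M0)//; have := i1 y; rewrite mul1r.
have Qx1 : real_norm S (Q x) <= 1 by have := Q1 x; rewrite x1 mulr1.
have fi1 : obound S (f \o i) 1.
  by rewrite -[1]mulr1; apply: obound_comp => //; exact: ler01.
have fiQx : 1 - b ^+ 2 / 8 < re S (f (i (Q x))).
  have := le_trans (re_le_rnorm S (f (x - P x))) (f1 _).
  rewrite linearB reB fx re1 mul1r rnorm_distC /=.
  by move: db xP; clear; rewrite /P /=; lra.
have [z [g [zg Qxz fg]]] := bollobas b0 b1 Qx1 fi1 fiQx.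
case/(statesP S): (zg) => z1 g1 gz.
(* Three replacements: [T x] by [P (T (P x))] costs [e2], then [f \o i] by [g] and [Q x] by [z] cost
   [b * M] each. *)
have gT0z : 1 - h' < real_norm S (g (T0 z) : K^o).
  pose w := T0 (Q x); have wE : i w = P (T (P x)) by [].
  have t1 := rnorm_triangle S (f (i w) : K^o) (f (T x)) (g (T0 z)).
  have t2 := rnorm_triangle S (g w : K^o) (f (i w)) (g (T0 z)).
  have t3 := rnormD S (f (T x) - g (T0 z) : K^o) (g (T0 z)); rewrite subrK in t3.
  have t4 : real_norm S (f (T x) - f (i w) : K^o) <= e2.
    rewrite -linearB; apply: le_trans (f1 _) _; rewrite mul1r rnorm_distC wE.
    by have := PTP x; rewrite /= x1 mulr1.
  have t5 : real_norm S (f (i w) - g w : K^o) <= b * M.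
    apply: le_trans (fg w) _; rewrite ler_pM2l//.
    by apply: le_trans (T0M _) _; rewrite ger_pMr.
  have t6 : real_norm S (g w - g (T0 z) : K^o) <= b * M.
    rewrite -!linearB; apply: le_trans (g1 _) _; rewrite mul1r.
    by apply: le_trans (T0M _) _; rewrite mulrC ler_pM2r// ltW.
  have t7 : 3 * (b * M) < gap by move: bg; clear -b0; lra.
  have t8 : real_norm S (f (T x) : K^o) = gap + (1 - h') by rewrite /gap subrK.
  move: e2g t1 t2 t3 t4 t5 t6 t7; rewrite t8; clear; lra.
pose nu := re S (numerical_radius T0).
have nuE : numerical_radius T0 = toK S nu.
  by rewrite toK_re//; exact: numerical_radius_ge0 T0M.
have nu_le1 : nu <= 1.
  rewrite -(ler_toK S) -nuE rmorph1 -nuT.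
  exact: (numerical_radius_compression Q1 i1 Qi' TM (ltW M0)).
have nu_gt : 1 - h' < nu.
  apply: lt_le_trans gT0z _; rewrite rnorm_le -nuE.
  exact: numerical_radius_ge T0M zg.
have nu0 : 0 < nu by move: nu_gt h'2; clear; lra.
have nuV : 0 <= nu^-1 by rewrite invr_ge0 ltW.
pose S0 : {linear Y -> Y} := (toK S nu^-1) \*: T0.
have nuS0 : numerical_radius S0 = 1 by apply: numerical_radius_normalized T0M _ _.
have cS0 : compact_operator S0.
  apply/compact_operatorZ/(compact_operator_sandwich cT _ cQ) => [|y y1].
    exact: obound_continuous T0M.
  exists (i y) => //; rewrite -(rmorph1 (toK S)) -rnorm_le.
  by apply: le_trans (i1 _) _; rewrite mul1r rnorm_le rmorph1.
(* As [nu <= 1], normalising can only increase the value, and [h' <= h]. *)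
have gS0z : 1 - eta (toK S e4) < `|g (S0 z)|.
  rewrite hE -(rmorph1 (toK S)) -rmorphB -(toK_rnorm S (g (S0 z) : K^o)) ltr_toK.
  rewrite /S0 /= linearZ rnormZ//; apply: le_lt_trans (_ : _ <= 1 - h') _.
    by rewrite lerD2l lerN2.
  apply: lt_le_trans gT0z _; rewrite ler_peMl ?rnorm_ge0//.
  by rewrite invf_ge1.
have [S1 [y [gy [cS1 ygy [nuS1 gyS1y] [S01 zy ggy]]]]] := bpb _ e4K _ _ _ cS0 zg nuS0 gS0z.
have [c1 c10 S1c] := continuous_obound S cS1.1.
have S01' : obound S (S0 \- S1) e4.
  apply: opnorm_obound; last exact: ltW S01.
  by move=> v; apply: continuousB; [exact: cS0.1|exact: cS1.1].
have ggy' : obound S (g \- gy) e4.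
  apply: opnorm_obound; last exact: ltW ggy.
  case/(statesP S): ygy => _ gy1 _.
  apply: (@obound_continuous _ _ S _ _ _ (1 + 1)) => u /=.
  by have := rnormB S (g u : K^o) (gy u); have := g1 u; have := gy1 u; clear; lra.
pose S2 : {linear X -> X} := i \o S1 \o Q.
pose f2 : {linear X -> K^o} := gy \o Q.
have st2 : states (i y, f2) by exact: (states_retract Q1 i1 Qi').
have S2c : obound S S2 c1.
  move=> u; apply: le_trans (i1 _) _; rewrite mul1r; apply: le_trans (S1c _) _.
  by rewrite ler_wpM2l//; have := Q1 u; rewrite mul1r.
have f2S2 : `|f2 (S2 (i y))| = 1 by rewrite /f2 /S2 /= !Qi'.
have nuS2 : numerical_radius S2 = 1.
  apply: le_anti; apply/andP; split.
    rewrite -(rmorph1 (toK S)); apply: numerical_radius_le; first exact: ler01.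
    have S1le v k : states (v, k) -> real_norm S (k (S1 v) : K^o) <= 1.
      by move=> vk; rewrite rnorm_le rmorph1 -nuS1; exact: numerical_radius_ge S1c vk.
    move=> v k vk; case: alt => [[absP ii]|[nY nX]].
      exact: (numerical_radius_absolute Q1 Qi' absP ii S1le vk).
    (* When the index of [Y] is 1, [S1] has norm at most 1, hence so has [S2]. *)
    apply: states_le vk.
    have S11 : obound S S1 1.
      apply: (@compact_numerical_index_le _ _ S _ S1 1 1) => //.
        by rewrite nY nX rmorph1.
      by move=> v' k' /S1le; rewrite mulr1.
    move=> u; apply: le_trans (i1 _) _; rewrite mul1r; apply: le_trans (S11 _) _.
    by rewrite mul1r; exact: Q1.
  by rewrite -f2S2; exact: numerical_radius_ge S2c st2.
exists S2, (i y), f2; split => //.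
  apply: (compact_operator_sandwich cS1 _ ci) => [|u u1].
    exact: obound_continuous S2c.
  exists (Q u) => //; rewrite -(rmorph1 (toK S)) -rnorm_le.
  by apply: le_trans (Q1 _) _; rewrite mul1r rnorm_le rmorph1.
have e_lt r : r < e -> toK S r < eps by rewrite eE ltr_toK.
have e42 : e / 2 < e by move: e0; clear; lra.
have e43 : 3 * e4 < e by move: e0; rewrite /e4; clear; lra.
have Qu u : real_norm S (Q u) <= real_norm S u by have := Q1 u; rewrite mul1r.
split.
(* From [T] to [i T0 Q] costs [e / 8], the normalisation [e / 8] and the property of [Y] [e / 4], in
   total [e / 2]. *)
- apply: le_lt_trans (e_lt _ e42); apply: obound_opnorm; first by rewrite divr_ge0// ltW.
  move=> u; pose v := Q u; have u0 := rnorm_ge0 S u.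
  have nuM : (nu^-1 - 1) * M <= e / 8.
    rewrite ler_pdivrMr// lerBlDr -[nu^-1]mul1r ler_pdivrMr//.
    move: nu_gt h'0 h'n h'2 (mulr_gt0 e0 n0_gt0); clear; nra.
  have t1 : real_norm S (T u - i (T0 v)) <= e / 8 * real_norm S u.
    rewrite rnorm_distC; apply: le_trans (PTP u) _.
    by rewrite ler_wpM2r.
  have t2 : real_norm S (T0 v - S0 v) <= e / 8 * real_norm S u.
    have -> : T0 v - S0 v = toK S (1 - nu^-1) *: T0 v.
      by rewrite rmorphB rmorph1 scalerBl scale1r.
    rewrite rnormZ_norm rnorm_toK distrC ger0_norm ?subr_ge0 ?invf_ge1//.
    apply: le_trans (_ : _ <= (nu^-1 - 1) * (M * real_norm S u)) _.
      rewrite ler_wpM2l ?subr_ge0 ?invf_ge1//; apply: le_trans (T0M _) _.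
      by rewrite ler_wpM2l ?(ltW M0)// Qu.
    by rewrite mulrA ler_wpM2r.
  have t3 : real_norm S (S0 v - S1 v) <= e4 * real_norm S u.
    by apply: le_trans (S01' v) _; rewrite ler_wpM2l ?(ltW e40)// Qu.
  have t4 : real_norm S (i (T0 v) - S2 u) <= real_norm S (T0 v - S1 v).
    by rewrite /S2 /= -linearB; apply: le_trans (i1 _) _; rewrite mul1r.
  have t5 := rnorm_triangle S (S0 v) (T0 v) (S1 v).
  have t6 := rnorm_triangle S (i (T0 v)) (T u) (S2 u).
  by move: t1 t2 t3 t4 t5 t6; rewrite /e4 /=; clear; lra.
(* The path from [x] to [i y] goes through [P x] and [i z], each leg being at most [e / 4]; the
   functionals are compared likewise through [f \o P] and [g \o Q]. *)
- rewrite -(toK_rnorm S); apply: e_lt; apply: le_lt_trans e43.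
  have t1 := rnorm_triangle S (P x) x (i y).
  have t2 := rnorm_triangle S z (Q x) y.
  have t3 : real_norm S (P x - i y) <= real_norm S (Q x - y).
    by rewrite /P /= -linearB; apply: le_trans (i1 _) _; rewrite mul1r.
  have t4 : real_norm S (z - y) < e4 by rewrite rnorm_lt.
  rewrite (rnorm_distC S x (P x)) in t1.
  by move: t1 t2 t3 t4 xP Qxz de be; clear; lra.
- apply: le_lt_trans (e_lt _ e43); apply: obound_opnorm; first by rewrite mulr_ge0// ltW.
  move=> u; pose v := Q u; have u0 := rnorm_ge0 S u.
  have t1 : real_norm S (f u - f (P u) : K^o) <= e4 * real_norm S u.
    by rewrite rnorm_distC; apply: le_trans (fP u) _; rewrite ler_wpM2r.
  have t2 : real_norm S (f (P u) - g v : K^o) <= e4 * real_norm S u.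
    by apply: le_trans (fg v) _; rewrite ler_pM ?rnorm_ge0 ?(ltW b0)// Qu.
  have t3 : real_norm S (g v - gy v : K^o) <= e4 * real_norm S u.
    by apply: le_trans (ggy' v) _; rewrite ler_wpM2l ?(ltW e40)// Qu.
  have t4 := rnorm_triangle S (f (P u) : K^o) (f u) (gy v).
  have t5 := rnorm_triangle S (g v : K^o) (f (P u)) (gy v).
  by move: t1 t2 t3 t4 t5; rewrite /f2 /=; clear; lra.
Qed.
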